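(* Let $n\ge1$. Consider the function sum: Alice has $X\in\{0,1\}^n$, Bob has $Y\in\{0,1\}^n$, and Charlie outputs $Z=X+Y\in\{0,1,2\}^n$ (component-wise integer sum). For every $p_{XY}$ with full support on $\{0,1\}^n\times\{0,1\}^n$, any secure protocol satisfies \[H(M_{31})\ge n\log 3,\quad H(M_{23})\ge n\log3,\quad H(M_{12})\ge 1.5\,n,\] and $\rho(p_{XY},\text{sum})\ge n\log 3$.
   Context: Setting: Alice (party 1) holds $X$, Bob (party 2) holds $Y$, $(X,Y)\sim p_{XY}$ on finite sets; Charlie (party 3) has no input and outputs $Z$, which should equal $f(X,Y)$ for the deterministic function $f$. In a protocol the parties, each with private randomness, exchange messages over multiple rounds on three pairwise private links, each message a codeword of a prefix-free code determined by previous messages on that link; the protocol terminates with probability 1 and may depend on $p_{XY}$. $M_{12},M_{23},M_{31}$ are the final transcripts on the Alice–Bob, Bob–Charlie, Charlie–Alice links; the view $V_i$ of party $i$ consists of the transcripts on its two links plus its input (Alice, Bob) or output (Charlie). A secure protocol satisfies correctness (Charlie outputs $f(x,y)$ on inputs $x,y$) and privacy (Markov chains $(M_{12},M_{31})-X-(Y,Z)$, $(M_{12},M_{23})-Y-(X,Z)$, $(M_{23},M_{31})-Z-(X,Y)$). $\rho(p_{XY},f)=\inf H(V_1,V_2,V_3|X,Y)$ over all secure protocols for $f$ with input distribution $p_{XY}$. Logs base 2. *)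

(* Defs.v *)
From HB Require Import structures.
From mathcomp Require Import all_boot all_order all_algebra.
From mathcomp Require Import all_classical all_reals.
From mathcomp Require Import ereal topology normedtype sequences esum exp.
Set Implicit Arguments. Unset Strict Implicit. Unset Printing Implicit Defensive.
Import Order.TTheory GRing.Theory Num.Theory.
Local Open Scope classical_set_scope.
Local Open Scope ring_scope.

(* Messages are bit strings. A link history is the list, round by round, of *)
(* the pair of messages sent on that link in the two directions.            *)
Definition msg := seq bool.
Definition lhist := seq (msg * msg).

(* One round of the (synchronous) protocol:
   ((Alice->Bob, Alice->Charlie), (Bob->Alice, Bob->Charlie),
    (Charlie->Alice, Charlie->Bob)).                                         *)
Definition round := ((msg * msg) * (msg * msg) * (msg * msg))%type.
Definition a2b (r : round) : msg := r.1.1.1.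
Definition a2c (r : round) : msg := r.1.1.2.
Definition b2a (r : round) : msg := r.1.2.1.
Definition b2c (r : round) : msg := r.1.2.2.
Definition c2a (r : round) : msg := r.2.1.
Definition c2b (r : round) : msg := r.2.2.
Definition round0 : round := (([::], [::]), ([::], [::]), ([::], [::])).

(* link histories of a global history h (list of rounds, oldest first) *)
Definition lh12 (h : seq round) : lhist := [seq (a2b r, b2a r) | r <- h].
Definition lh23 (h : seq round) : lhist := [seq (b2c r, c2b r) | r <- h].
Definition lh31 (h : seq round) : lhist := [seq (c2a r, a2c r) | r <- h].

Definition trans (l : lhist) : msg := flatten [seq m.1 ++ m.2 | m <- l].

Definition prefix_free (C : msg -> bool) : Prop :=
  forall u v, C u -> C v -> prefix u v -> u = v.

(* A protocol.  Party i's private randomness is represented behaviourally: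
   in each round, each party draws the pair of messages it sends on its two
   links from a probability mass function that depends on its current view
   (its input, if any, and the transcripts so far on its two links, which
   include the messages it sent itself).  The code used on each directed link
   in a round is determined by the history of that link.  Charlie's output is
   a function of his final transcripts (M23, M31). *)
Record protocol (R : realType) (TX TY TZ : finType) := Protocol {
  code_ab : lhist -> msg -> bool;
  code_ba : lhist -> msg -> bool;
  code_bc : lhist -> msg -> bool;
  code_cb : lhist -> msg -> bool;
  code_ca : lhist -> msg -> bool;
  code_ac : lhist -> msg -> bool;
  (* pmf of (Alice->Bob, Alice->Charlie) given x, hist 12, hist 31 *)
  alice : TX -> lhist -> lhist -> msg * msg -> R;
  (* pmf of (Bob->Alice, Bob->Charlie) given y, hist 12, hist 23 *)
  bob : TY -> lhist -> lhist -> msg * msg -> R;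
  (* pmf of (Charlie->Alice, Charlie->Bob) given hist 23, hist 31 *)
  charlie : lhist -> lhist -> msg * msg -> R;
  output : msg -> msg -> TZ
}.

Section Protocols.
Variables (R : realType) (TX TY TZ : finType).
Implicit Types (pi : protocol R TX TY TZ).

Definition is_pmf (T : choiceType) (q : T -> R) : Prop :=
  (forall t, 0 <= q t) /\ (\esum_(t in [set: T]) (q t)%:E = 1%E).

Definition valid_protocol pi : Prop :=
  ((forall l, prefix_free (code_ab pi l)) /\ (forall l, prefix_free (code_ba pi l)) /\
   (forall l, prefix_free (code_bc pi l)) /\ (forall l, prefix_free (code_cb pi l)) /\
   (forall l, prefix_free (code_ca pi l)) /\ (forall l, prefix_free (code_ac pi l))) /\
  ((forall x l1 l3, is_pmf (alice pi x l1 l3) /\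
      (forall m, alice pi x l1 l3 m != 0 -> code_ab pi l1 m.1 && code_ac pi l3 m.2)) /\
   (forall y l1 l2, is_pmf (bob pi y l1 l2) /\
      (forall m, bob pi y l1 l2 m != 0 -> code_ba pi l1 m.1 && code_bc pi l2 m.2)) /\
   (forall l2 l3, is_pmf (charlie pi l2 l3) /\
      (forall m, charlie pi l2 l3 m != 0 -> code_ca pi l3 m.1 && code_cb pi l2 m.2))).

Definition step_prob pi (x : TX) (y : TY) (hp : seq round) (r : round) : R :=
  alice pi x (lh12 hp) (lh31 hp) r.1.1 *
  bob pi y (lh12 hp) (lh23 hp) r.1.2 *
  charlie pi (lh23 hp) (lh31 hp) r.2.

Definition hist_prob pi x y (h : seq round) : R :=
  \prod_(k < size h) step_prob pi x y (take k h) (nth round0 h k).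

Definition transcripts (h : seq round) : msg * msg * msg :=
  (trans (lh12 h), trans (lh23 h), trans (lh31 h)).

Definition trans_prob_at pi x y (t : nat) (m : msg * msg * msg) : \bar R :=
  \esum_(h in [set h : seq round | size h = t /\ transcripts h = m])
     (hist_prob pi x y h)%:E.

(* P( final (M12,M23,M31) = m | x, y ): the transcripts are non-decreasing
   (w.r.t. prefix) in time; the final transcript is their eventual value *)
Definition final_prob pi x y (m : msg * msg * msg) : \bar R :=
  limn (fun t => trans_prob_at pi x y t m).

Definition terminates pi : Prop :=
  forall x y, \esum_(m in [set: msg * msg * msg]) final_prob pi x y m = 1%E.

Definition Omega := (TX * TY * (msg * msg * msg))%type.
Definition joint (p : TX -> TY -> R) pi (w : Omega) : \bar R :=
  (p w.1.1 w.1.2)%:E * final_prob pi w.1.1 w.1.2 w.2.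

Definition rvX (w : Omega) : TX := w.1.1.
Definition rvY (w : Omega) : TY := w.1.2.
Definition rvM12 (w : Omega) : msg := w.2.1.1.
Definition rvM23 (w : Omega) : msg := w.2.1.2.
Definition rvM31 (w : Omega) : msg := w.2.2.
Definition rvZ pi (w : Omega) : TZ := output pi (rvM23 w) (rvM31 w).
Definition V1 (w : Omega) := (rvM12 w, rvM31 w, rvX w).
Definition V2 (w : Omega) := (rvM12 w, rvM23 w, rvY w).
Definition V3 pi (w : Omega) := (rvM23 w, rvM31 w, rvZ pi w).

End Protocols.

Section Info.
Variables (R : realType).

Definition log2 (x : R) : R := ln x / ln 2.

Definition pmfRV (Om T : choiceType) (P : Om -> \bar R) (W : Om -> T) (w : T)
  : \bar R := \esum_(o in [set o | W o = w]) P o.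

Definition entropy (Om T : choiceType) (P : Om -> \bar R) (W : Om -> T) : \bar R :=
  \esum_(w in [set: T])
    (let q := fine (pmfRV P W w) in - (q * log2 q))%:E.

Definition condP (Om U : choiceType) (P : Om -> \bar R) (Uv : Om -> U) (u : U)
  (o : Om) : \bar R :=
  if Uv o == u then (fine (P o) / fine (pmfRV P Uv u))%:E else 0%E.

Definition centropy (Om T U : choiceType) (P : Om -> \bar R) (W : Om -> T)
  (Uv : Om -> U) : \bar R :=
  \esum_(u in [set: U]) (pmfRV P Uv u * entropy (condP P Uv u) W)%E.

Definition markov (Om TA TB TC : choiceType) (P : Om -> \bar R)
  (A : Om -> TA) (B : Om -> TB) (C : Om -> TC) : Prop :=
  forall a b c,
    (pmfRV P (fun o => (A o, B o, C o)) (a, b, c) * pmfRV P B b)%E =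
    (pmfRV P (fun o => (A o, B o)) (a, b) * pmfRV P (fun o => (B o, C o)) (b, c))%E.

End Info.

Section Security.
Variables (R : realType) (TX TY TZ : finType).

Definition secure (p : TX -> TY -> R) (f : TX -> TY -> TZ)
  (pi : protocol R TX TY TZ) : Prop :=
  [/\ valid_protocol pi,
      terminates pi,
      (forall x y m, final_prob pi x y m != 0%E -> output pi m.1.2 m.2 = f x y) &
      (* privacy *) (
      markov (joint p pi) (fun w => (rvM12 w, rvM31 w)) (@rvX TX TY)
             (fun w => (rvY w, rvZ pi w)) /\
      markov (joint p pi) (fun w => (rvM12 w, rvM23 w)) (@rvY TX TY)
             (fun w => (rvX w, rvZ pi w)) /\
      markov (joint p pi) (fun w => (rvM23 w, rvM31 w)) (rvZ pi)
             (fun w => (rvX w, rvY w)))].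

Definition rho (p : TX -> TY -> R) (f : TX -> TY -> TZ) : \bar R :=
  ereal_inf [set centropy (joint p pi)
                 (fun w => (V1 w, V2 w, V3 pi w)) (fun w => (rvX w, rvY w))
            | pi in [set pi | secure p f pi]].

End Security.

Definition full_support_dist (R : realType) (TX TY : finType)
  (p : TX -> TY -> R) : Prop :=
  (forall x y, 0 < p x y) /\ \sum_(xy : TX * TY) p xy.1 xy.2 = 1.

Definition bitvec (n : nat) := {ffun 'I_n -> bool}.
Definition tritvec (n : nat) := {ffun 'I_n -> 'I_3}.
Definition sumf (n : nat) (x y : bitvec n) : tritvec n :=
  [ffun i => inord (x i + y i)%N].

(* Main.v *)
(* By privacy, the transcripts on Alice's links depend only on x, those on Bob's
   links only on y, and those on Charlie's links only on f(x,y).  For the sum,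
   each single transcript is therefore independent of (x,y), so its entropy may
   be computed for any convenient input distribution.
   - If X+Y is uniform, then M23 is independent of X+Y, which is a function of
     (M23,M31), so H(M31) >= I(M31; X+Y | M23) = n log 3, and symmetrically for
     M23.  The bound on rho follows since H(M31|X,Y) = H(M31).
   - For H(M12), take X and Y independent and uniform.  Every message is
     drawn from its sender's view, so given that party's two transcripts it is
     independent of the third one; hence the interaction information
     I(M12;M31) - I(M12;M31|M23) never decreases along the protocol, and
       H(M12) = H(M12|M31) + I(M12;M31) >= H(M12|M31) + I(M12;M31|M23)
              >= H(X) + I(Y;Z) = n + n/2,
     because X is a function of (M12,M31), Y of (M12,M23) and Z of (M23,M31).
     This runs on the histories after t rounds, which are functions of the
     final transcripts by prefix-freeness, with Fano's inequality absorbing the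
     probability that the protocol is not yet finished.
   Since entropies may be infinite, inequalities between them are proved
   pointwise, up to terms of the form r - 1 with E[r] <= 1 (Gibbs). *)
Require Import Defs.
From HB Require Import structures.
From mathcomp Require Import all_boot all_order all_algebra.
From mathcomp Require Import finmap.
From mathcomp Require Import all_classical all_reals.
From mathcomp Require Import ereal topology normedtype sequences esum exp.
From mathcomp Require Import ring lra.
Import Order.TTheory GRing.Theory Num.Theory.
Local Open Scope ring_scope.
Set Implicit Arguments.
Unset Strict Implicit.
Local Open Scope classical_set_scope.

(** * Sums of nonnegative families *)

Section NonnegativeSums.
Context {R : realType}.
Implicit Types (I J : choiceType).
Local Open Scope ereal_scope.

Lemma esum_prod {I J} (a : I -> J -> \bar R) : (forall i j, 0 <= a i j) ->
  \esum_(i in [set: I]) \esum_(j in [set: J]) a i j =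
  \esum_(k in [set: I * J]) a k.1 k.2.
Proof.
move=> a0; rewrite esum_esum//; congr esum.
by apply/seteqP; split.
Qed.

Lemma exchange_esum {I J} (a : I -> J -> \bar R) : (forall i j, 0 <= a i j) ->
  \esum_(i in [set: I]) \esum_(j in [set: J]) a i j =
  \esum_(j in [set: J]) \esum_(i in [set: I]) a i j.
Proof.
move=> a0; rewrite !esum_prod//.
rewrite (reindex_esum [set: J * I] _ (fun x => (x.2, x.1)))//; split=> //=.
- by move=> [i1 i2] [j1 j2] /= _ _ [] -> ->.
- by move=> [i1 i2] _ /=; exists (i2, i1).
Qed.

Lemma le_esum_sub {I} (A B : set I) (a : I -> \bar R) :
  (forall i, 0 <= a i) -> A `<=` B ->
  \esum_(i in A) a i <= \esum_(i in B) a i.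
Proof.
move=> a0 AB; rewrite esum_mkcond [leRHS]esum_mkcond; apply: le_esum => i _.
case: ifPn => [/set_mem/AB/mem_set ->//|_]; by case: ifP.
Qed.

Lemma esum_ge1 {I} (A : set I) (a : I -> \bar R) i :
  (forall i, 0 <= a i) -> A i -> a i <= \esum_(i in A) a i.
Proof.
move=> a0 Ai; rewrite -[leLHS](esum_set1 (t := i) (a := a))//.
by apply: le_esum_sub => // j ->.
Qed.

Lemma esum_eq1 {I} (A : set I) (a : I -> \bar R) i0 : (0 <= a i0) -> A i0 ->
  (forall i, A i -> i <> i0 -> a i = 0) -> \esum_(i in A) a i = a i0.
Proof.
move=> a0 Ai0 h; rewrite -[RHS](esum_set1 (t := i0) (a := a))//.
rewrite esum_mkcond [RHS]esum_mkcond; apply: eq_esum => i _.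
have [->|ii0] := eqVneq i i0; first by rewrite !mem_set.
rewrite (@memNset _ [set i0]) => [|/= /eqP]; last by rewrite (negPf ii0).
by case: ifPn => // /set_mem Ai; apply: h => //; apply/eqP.
Qed.

(** The nonnegative difference [b - a] has total 0, because both totals are finite and equal. *)
Lemma eq_of_le_esum {I} (a b : I -> R) (A : set I) : (forall i, A i -> (0 <= a i <= b i)%R) ->
  \esum_(i in A) (a i)%:E = 1 -> \esum_(i in A) (b i)%:E = 1 ->
  forall i, A i -> a i = b i.
Proof.
move=> ab a1 b1 i Ai; pose d i := (if i \in A then b i - a i else 0)%R.
have d0 j : 0 <= (d j)%:E.
  rewrite lee_fin /d; case: ifPn => // /set_mem /ab /andP[_].
  by rewrite subr_ge0.
have : \esum_(i in A) ((a i)%:E + (d i)%:E) = 1.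
  rewrite -b1; apply: eq_esum => j Aj.
  by rewrite /d mem_set// -EFinD addrC subrK.
rewrite esumD// => [|j /ab/andP[]]; last by rewrite lee_fin.
rewrite a1 => h; have {}h : \esum_(i in A) (d i)%:E = 0.
  have := esum_ge0 (fun j (_ : A j) => d0 j).
  case: esum h => //= r.
  by rewrite -EFinD => -[/(canRL (addKr _))]; rewrite addNr => ->.
have := esum_ge1 d0 Ai; rewrite h lee_fin /d mem_set// subr_le0 => ba.
by apply/eqP; rewrite eq_le ba andbT; have /andP[] := ab _ Ai.
Qed.

Lemma esum_fiber {I J} (W : I -> J) (S : set I) (a : I -> \bar R) :
  (forall i, 0 <= a i) ->
  \esum_(i in S) a i =
  \esum_(w in [set: J]) \esum_(i in [set i | S i /\ W i = w]) a i.
Proof.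
move=> a0; under [RHS]eq_esum do rewrite esum_mkcond.
rewrite exchange_esum; last by move=> ? ?; case: ifP.
rewrite esum_mkcond; apply: eq_esum => i _.
have -> : (fun j => if i \in [set i | S i /\ W i = j] then a i else 0) =
          (fun j => if j \in [set W i] then (if i \in S then a i else 0) else 0).
  apply/funext => j; case: ifPn => [/set_mem[Si <-]|].
    by rewrite !mem_set.
  move=> /negP h; case: ifPn => // /set_mem jW; case: ifPn => // /set_mem Si.
  by exfalso; apply: h; apply/mem_set.
by rewrite -esum_mkcond esum_set1//; case: ifP.
Qed.

Lemma le_esumZl {I} (S : set I) (c : R) (a : I -> \bar R) :
  (0 <= c)%R -> (forall i, 0 <= a i) ->
  \esum_(i in S) (c%:E * a i) <= c%:E * \esum_(i in S) a i.
Proof.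
move=> c0 a0; apply: ge_ereal_sup => _ [X [finX XS] <-].
rewrite -ge0_mule_fsumr//; apply: lee_wpmul2l; first by rewrite lee_fin.
by apply: esum_ge; exists X.
Qed.

Lemma esumZl {I} (S : set I) (c : R) (a : I -> \bar R) :
  (0 <= c)%R -> (forall i, 0 <= a i) ->
  \esum_(i in S) (c%:E * a i) = c%:E * \esum_(i in S) a i.
Proof.
move=> c0 a0; apply/eqP; rewrite eq_le le_esumZl//=.
have [->|cn0] := eqVneq c 0%R.
  by rewrite mul0e esum_ge0// => i _; rewrite mul0e.
have cp : (0 < c)%R by rewrite lt_neqAle eq_sym cn0.
(* The reverse inequality is [le_esumZl] again, now with factor [c^-1]. *)
rewrite -[leRHS]mul1e -(@mulfV _ c)// EFinM -muleA.
apply: lee_wpmul2l; first by rewrite lee_fin.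
rewrite -[leLHS](eq_esum (a := fun i => c^-1%:E * (c%:E * a i))).
  apply: le_esumZl; first by rewrite invr_ge0.
  by move=> i; rewrite mule_ge0// lee_fin.
by move=> i _; rewrite muleA -EFinM mulVf// mul1e.
Qed.

Lemma esum_EFinM {I} (S : set I) (c : R) (f : I -> R) :
  (0 <= c)%R -> (forall i, 0 <= f i)%R ->
  \esum_(i in S) (c * f i)%:E = c%:E * \esum_(i in S) (f i)%:E.
Proof. by move=> c0 f0; under eq_esum do rewrite EFinM; rewrite esumZl. Qed.

Lemma esum_finType {T : finType} (a : T -> \bar R) : (forall i, 0 <= a i) ->
  \esum_(i in [set: T]) a i = \sum_i a i.
Proof.
move=> a0.
rewrite (eq_esum (b := fun i => \sum_j if i \in [set j] then a i else 0)).
  rewrite esum_sum => [|i j _ _]; last by case: ifP.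
  by apply: eq_bigr => j _; rewrite -esum_mkcond esum_set1.
move=> i _; rewrite (bigD1 i)//= mem_set// big1 ?adde0// => j ji.
by rewrite memNset// => /= ij; move: ji; rewrite ij eqxx.
Qed.

End NonnegativeSums.

(** * Discrete probability and surprisals *)

Section DiscreteProbability.
Context {R : realType} {Om : choiceType} (P : Om -> R).
Hypothesis P0 : forall o, 0 <= P o.
Hypothesis P1 : \esum_(o in [set: Om]) (P o)%:E = 1%E.
Implicit Types (T U V TA TB TC TU TV : choiceType).

(** Real-valued, so that logarithms and quotients apply; [fine] loses nothing because masses are at
    most 1. *)
Definition pmass {T} (W : Om -> T) (w : T) : R :=
  fine (\esum_(o in [set o | W o = w]) (P o)%:E).

(** A supremum of finite sums: this is the expectation, possibly infinite, when [f] is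
    nonnegative. *)
Definition expect (f : Om -> R) : \bar R :=
  \esum_(o in [set: Om]) (P o * f o)%:E.

(** Self-information in nats; its expectation is ln 2 times the entropy in bits. *)
Definition surprisal {T} (W : Om -> T) (o : Om) : R := - ln (pmass W (W o)).

Let PE0 o : (0 <= (P o)%:E)%E. Proof. by rewrite lee_fin. Qed.

Lemma pmassE {T} (W : Om -> T) w :
  (pmass W w)%:E = \esum_(o in [set o | W o = w]) (P o)%:E.
Proof.
rewrite fineK// ge0_fin_numE ?esum_ge0//.
by apply: (@le_lt_trans _ _ 1%E); rewrite ?ltry// -P1; apply: le_esum_sub.
Qed.

Lemma pmass_ge0 {T} (W : Om -> T) w : 0 <= pmass W w.
Proof. by rewrite -lee_fin pmassE esum_ge0. Qed.

Lemma pmass_le1 {T} (W : Om -> T) w : pmass W w <= 1.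
Proof. by rewrite -lee_fin pmassE -P1; apply: le_esum_sub. Qed.

Lemma le_pmass {T} (W : Om -> T) o : P o <= pmass W (W o).
Proof. by rewrite -lee_fin pmassE; apply: (esum_ge1 (a := fun o => (P o)%:E)). Qed.

Lemma pmass_gt0 {T} (W : Om -> T) o : 0 < P o -> 0 < pmass W (W o).
Proof. by move=> /lt_le_trans; apply; exact: le_pmass. Qed.

Lemma support_nonempty : exists o, 0 < P o.
Proof.
apply: contrapT => nP; move: P1; rewrite esum1 => [/eqP|o _].
  by rewrite eqe eq_sym oner_eq0.
apply/eqP; rewrite eqe; apply: contrapT => /negP Po; apply: nP; exists o.
by rewrite lt_neqAle eq_sym Po P0.
Qed.

Lemma pmass_gt0_ex {T} (W : Om -> T) w : 0 < pmass W w ->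
  exists2 o, 0 < P o & W o = w.
Proof.
move=> w0; apply: contrapT => h; move: w0; rewrite -lte_fin pmassE esum1 ?ltxx//.
move=> o Wo; apply/eqP; rewrite eqe; apply: contrapT => /negP Po.
by apply: h; exists o; rewrite // lt_neqAle eq_sym Po P0.
Qed.

Lemma le_pmass_imp {T U} (W : Om -> T) (V : Om -> U) w v :
  (forall o, 0 < P o -> W o = w -> V o = v) -> pmass W w <= pmass V v.
Proof.
move=> WV; rewrite -lee_fin !pmassE.
rewrite esum_mkcond [leRHS]esum_mkcond; apply: le_esum => o _.
case: ifPn => [/set_mem Wo|_]; last by case: ifP.
have [->|Po] := eqVneq (P o) 0; first by case: ifP.
by rewrite mem_set//=; apply: WV => //; rewrite lt_neqAle eq_sym Po P0.
Qed.

Lemma eq_pmass {T U} (W : Om -> T) (V : Om -> U) w v :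
  (forall o, 0 < P o -> W o = w <-> V o = v) -> pmass W w = pmass V v.
Proof.
move=> WV; apply/eqP; rewrite eq_le; apply/andP.
by split; apply: le_pmass_imp => o Po; apply WV.
Qed.

Lemma eq_pmass_fun {T} (W V : Om -> T) w :
  (forall o, 0 < P o -> W o = V o) -> pmass W w = pmass V w.
Proof. by move=> WV; apply: eq_pmass => o /WV ->. Qed.

Lemma esum_pmass {T} (W : Om -> T) (F : T -> R) : (forall w, 0 <= F w) ->
  \esum_(w in [set: T]) (pmass W w * F w)%:E = expect (F \o W).
Proof.
move=> F0; rewrite /expect (esum_fiber W); last first.
  by move=> o; rewrite lee_fin mulr_ge0//=.
apply: eq_esum => w _; rewrite mulrC EFinM pmassE -esumZl//.
have -> : [set i | [set: Om] i /\ W i = w] = [set i | W i = w].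
  by apply/seteqP; split => o /= => [[]|].
by apply: eq_esum => o /= <-; rewrite mulrC EFinM.
Qed.

Lemma esum_pmass1 {T} (W : Om -> T) : \esum_(w in [set: T]) (pmass W w)%:E = 1%E.
Proof.
have := esum_pmass W (F := fun=> 1) (fun=> ler01).
under eq_esum do rewrite mulr1; move=> ->.
by rewrite /expect -P1; apply: eq_esum => o _ /=; rewrite mulr1.
Qed.

Lemma pmass_pair {T U} (W : Om -> T) (V : Om -> U) w :
  \esum_(v in [set: U]) (pmass (fun o => (W o, V o)) (w, v))%:E = (pmass W w)%:E.
Proof.
rewrite pmassE (esum_fiber V)//; apply: eq_esum => v _; rewrite pmassE.
congr esum; apply/seteqP; split => o /=; first by case.
by move=> [-> ->].
Qed.

Lemma pmass_comp {T U} (g : T -> U) (W : Om -> T) u :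
  (pmass (g \o W) u)%:E = \esum_(w in [set w | g w = u]) (pmass W w)%:E.
Proof.
rewrite pmassE (esum_fiber W)// [RHS]esum_mkcond; apply: eq_esum => w _.
case: ifPn => [/set_mem /= gw|/negP gw].
  rewrite pmassE; congr esum; apply/seteqP; split => o /=; first by case.
  by move=> ->.
rewrite esum1// => o [/= gWo Wo]; exfalso; apply: gw; apply/mem_set => /=.
by rewrite -Wo.
Qed.

Lemma expect_ge0 f : (forall o, 0 <= f o) -> (0 <= expect f)%E.
Proof. by move=> f0; apply: esum_ge0 => o _; rewrite lee_fin mulr_ge0. Qed.

Lemma le_expect f g : (forall o, 0 < P o -> f o <= g o) -> (expect f <= expect g)%E.
Proof.
move=> fg; apply: le_esum => o _; rewrite lee_fin.
have := P0 o; rewrite le_eqVlt => /predU1P[<-|Po]; first by rewrite !mul0r.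
by rewrite ler_wpM2l// fg.
Qed.

Lemma expectD f g : (forall o, 0 <= f o) -> (forall o, 0 <= g o) ->
  expect (fun o => f o + g o) = (expect f + expect g)%E.
Proof.
move=> f0 g0; rewrite /expect -esumD => [|o _|o _]; rewrite ?lee_fin ?mulr_ge0//.
by apply: eq_esum => o _; rewrite mulrDr EFinD.
Qed.

Lemma expect_cst (c : R) : 0 <= c -> expect (fun=> c) = c%:E.
Proof.
move=> c0; rewrite -[RHS]mule1 -P1 -esumZl//.
by apply: eq_esum => o _; rewrite -EFinM mulrC.
Qed.

Lemma surprisal_ge0 {T} (W : Om -> T) o : 0 <= surprisal W o.
Proof. by rewrite oppr_ge0 ln_le0// pmass_le1. Qed.

(** Pointwise data processing: up to null points, the fibre of [W] through [o] lies inside that of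
    [V]. *)
Lemma le_surprisal {T U} (W : Om -> T) (V : Om -> U) o : 0 < P o ->
  (forall o', 0 < P o' -> W o' = W o -> V o' = V o) ->
  surprisal V o <= surprisal W o.
Proof.
move=> Po WV; rewrite lerN2 ler_ln ?posrE ?pmass_gt0//.
exact: le_pmass_imp.
Qed.

Lemma eq_surprisal {T U} (W : Om -> T) (V : Om -> U) o :
  (forall o', 0 < P o' -> W o' = W o <-> V o' = V o) ->
  surprisal V o = surprisal W o.
Proof.
move=> WV; congr (- ln _).
by apply: eq_pmass => o' /WV []; split.
Qed.

(* [bounded_mean d e] says that the expectation of the signed function [d] is
   at most [e], without requiring [d] to be summable. *)
Definition bounded_mean (d : Om -> R) (e : R) := exists c s,
  [/\ 0 <= c, forall o, 0 <= s o, (expect s <= (c + e)%:E)%E &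
      forall o, 0 < P o -> d o <= s o - c].

Lemma bounded_meanW d d' e e' : e <= e' -> (forall o, 0 < P o -> d' o <= d o) ->
  bounded_mean d e -> bounded_mean d' e'.
Proof.
move=> ee' dd' [c [s [c0 s0 se ds]]]; exists c, s; split => //.
  by apply: (le_trans se); rewrite lee_fin lerD2l.
by move=> o Po; apply: le_trans (dd' _ Po) (ds _ Po).
Qed.

Lemma bounded_meanD d d' e e' : bounded_mean d e -> bounded_mean d' e' ->
  bounded_mean (fun o => d o + d' o) (e + e').
Proof.
move=> [c [s [c0 s0 se ds]]] [c' [s' [c'0 s'0 se' ds']]].
exists (c + c'), (fun o => s o + s' o); split.
- exact: addr_ge0.
- by move=> o; rewrite addr_ge0.
- by rewrite expectD// addrACA EFinD leeD.
- by move=> o Po; rewrite opprD addrACA lerD ?ds ?ds'.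
Qed.

(** Together with ln r <= r - 1 this is Gibbs' inequality; [r] will be a likelihood ratio. *)
Lemma bounded_mean_ratio r : (forall o, 0 <= r o) -> (expect r <= 1)%E ->
  bounded_mean (fun o => r o - 1) 0.
Proof. by move=> r0 r1; exists 1, r; split; rewrite ?addr0. Qed.

Lemma bounded_mean0 : bounded_mean (fun=> 0) 0.
Proof.
exists 0, (fun=> 0); by split => //=; rewrite addr0 expect_cst.
Qed.

Lemma bounded_mean_finite {T : finType} (W : Om -> T) (g : T -> R) :
  bounded_mean (g \o W) (\sum_w pmass W w * g w).
Proof.
(* Shifting by [c] makes [g] nonnegative, so that [expect] is additive on it. *)
pose c := \sum_w `|g w|.
have gc w : 0 <= g w + c.
  have : `|g w| <= c by rewrite /c (bigD1 w)//= lerDl sumr_ge0.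
  by rewrite ler_norml => /andP[]; lra.
have c0 : 0 <= c by apply: sumr_ge0.
exists c, (fun o => g (W o) + c); split => //; last by move=> o _ /=; rewrite addrK.
rewrite -[leLHS](esum_pmass W gc) esum_finType; last first.
  by move=> w; rewrite lee_fin mulr_ge0// pmass_ge0.
rewrite sumEFin lee_fin; under eq_bigr do rewrite mulrDr.
rewrite big_split/= addrC lerD2r -mulr_suml.
suff -> : \sum_i pmass W i = 1 by rewrite mul1r.
apply: EFin_inj; rewrite -(esum_pmass1 W) esum_finType ?sumEFin// => w.
by rewrite lee_fin pmass_ge0.
Qed.

(** The way back to entropies. The witnesses give c <= s + f on the support, hence c <= (c - K) +
    E[f]; an infinite E[f] does no harm. *)
Lemma bounded_mean_opp f K : (forall o, 0 <= f o) ->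
  bounded_mean (fun o => - f o) (- K) -> (K%:E <= expect f)%E.
Proof.
move=> f0 [c [s [c0 s0 se ds]]].
have : (expect (fun=> c) <= expect (fun o => (s o + f o)%R))%E.
  by apply: le_expect => o /ds; lra.
rewrite expect_cst// expectD// => /le_trans /(_ (leeD se (lexx _))).
case: (expect f) (expect_ge0 f0) => [r _|_ _|//]; last by rewrite leey.
by rewrite -EFinD !lee_fin; lra.
Qed.

(** Nonnegativity of I(A;B|C) by Gibbs' inequality: [q] is the law with the true marginals on (C,A)
    and (C,B) that makes A and B independent given C, and the density in question is the logarithm
    of its ratio [r] to the true law. *)
Lemma submodularity {T U V} (A : Om -> T) (B : Om -> U) (C : Om -> V) :
  bounded_mean (fun o => surprisal (fun o => (C o, A o, B o)) o + surprisal C o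
    - surprisal (fun o => (C o, A o)) o - surprisal (fun o => (C o, B o)) o) 0.
Proof.
pose q (w : V * T * U) := pmass (fun o => (C o, A o)) w.1 *
  pmass (fun o => (C o, B o)) (w.1.1, w.2) / pmass C w.1.1.
pose r w := q w / pmass (fun o => (C o, A o, B o)) w.
have q0 w : 0 <= q w by rewrite !mulr_ge0 ?invr_ge0 ?pmass_ge0.
have r0 w : 0 <= r w by rewrite !mulr_ge0 ?invr_ge0 ?pmass_ge0.
have r1 : (expect (r \o (fun o => (C o, A o, B o))) <= 1)%E.
  rewrite -esum_pmass//.
  apply: (@le_trans _ _ (\esum_(w in [set: V * T * U]) (q w)%:E)).
    apply: le_esum => w _; rewrite lee_fin.
    have [->|h] := eqVneq (pmass (fun o => (C o, A o, B o)) w) 0.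
      by rewrite mul0r.
    by rewrite mulrC /r mulfVK.
  rewrite -(esum_prod (a := fun i j => (q (i, j))%:E)); last first.
    by move=> i j; rewrite lee_fin.
  have -> : \esum_(i in [set: V * T]) \esum_(j in [set: U]) (q (i, j))%:E =
     \esum_(i in [set: V * T]) ((pmass (fun o => (C o, A o)) i * (pmass C i.1)^-1)
        * pmass C i.1)%:E.
    apply: eq_esum => i _; rewrite EFinM -(pmass_pair C B) -esumZl//.
    - by apply: eq_esum => j _; rewrite -EFinM /q/= mulrAC.
    - by rewrite mulr_ge0 ?invr_ge0 ?pmass_ge0.
    - by move=> j; rewrite lee_fin pmass_ge0.
  rewrite -(esum_pmass1 (fun o => (C o, A o))); apply: le_esum => i _.
  rewrite lee_fin -mulrA ler_piMr ?pmass_ge0//.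
  (* Dividing by a zero mass yields 0, which keeps the inequality. *)
  have [->|h] := eqVneq (pmass C i.1) 0; first by rewrite mulr0.
  by rewrite mulVf.
have B1 := bounded_mean_ratio (r := r \o (fun o => (C o, A o, B o))) (fun=> r0 _) r1.
apply: (bounded_meanW _ _ B1) => // o Po /=.
have [c0 ca0 cb0 cab0] := And4 (pmass_gt0 C Po) (pmass_gt0 (fun o => (C o, A o)) Po)
 (pmass_gt0 (fun o => (C o, B o)) Po) (pmass_gt0 (fun o => (C o, A o, B o)) Po).
have rp : 0 < r (C o, A o, B o) by rewrite /r /q/= !mulr_gt0 ?invr_gt0.
have -> : surprisal (fun o => (C o, A o, B o)) o + surprisal C o
  - surprisal (fun o => (C o, A o)) o - surprisal (fun o => (C o, B o)) o =
  ln (r (C o, A o, B o)).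
  rewrite /surprisal /r /q/= !lnM ?posrE ?mulr_gt0 ?invr_gt0// !lnV ?posrE//.
  lra.
rewrite -[X in ln X](addrNK 1) addrC.
by apply: le_ln1Dx; lra.
Qed.

(** Fano's inequality with a free parameter [d] in place of the binary entropy. It is Gibbs'
    inequality against the conditional law [Q] that puts 1 - d on the guess and d/#|T| on every
    other value: a right guess costs -ln(1-d), a wrong one ln(#|T|/d). *)
Lemma fano {T : finType} {U} (X : Om -> T) (W : Om -> U) (g : U -> T) (d : R) :
  0 < d < 1 ->
  bounded_mean (fun o => surprisal (fun o => (W o, X o)) o - surprisal W o)
    (- ln (1 - d) + (1 - pmass (fun o => X o == g (W o)) true) * ln (#|T|%:R / d)).
Proof.
move=> /andP[d0 d1].
have [N0|Tn] := posnP #|T|.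
  exfalso; move: P1; rewrite esum1 => [/eqP|o].
    by rewrite eqe eq_sym oner_eq0.
  by have := fintype0 (X o) N0.
have N1 : 1 <= #|T|%:R :> R by rewrite ler1n.
have N0 : 0 < #|T|%:R :> R by rewrite ltr0n.
pose Q (w : U * T) : R := if w.2 == g w.1 then 1 - d else d / #|T|%:R.
have Qp w : 0 < Q w by rewrite /Q; case: ifP => _; rewrite ?divr_gt0// subr_gt0.
have Qsum u : \sum_x Q (u, x) <= 1.
  rewrite /Q (bigD1 (g u))//= eqxx (eq_bigr (fun=> d / #|T|%:R)); last first.
    by move=> i /negPf ->.
  have : \sum_(i | i != g u) d / #|T|%:R <= \sum_(i : T) d / #|T|%:R.
    by rewrite [in leRHS](bigD1 (g u))//= lerDr divr_ge0 ?ltW.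
  have -> : \sum_(i : T) d / #|T|%:R = d by rewrite sumr_const -[LHS]mulr_natr divfK ?gt_eqF.
  by lra.
pose r w := Q w * pmass W w.1 / pmass (fun o => (W o, X o)) w.
have r0 w : 0 <= r w by rewrite !mulr_ge0 ?invr_ge0 ?pmass_ge0// ltW.
have r1 : (expect (r \o (fun o => (W o, X o))) <= 1)%E.
  rewrite -esum_pmass//.
  apply: (@le_trans _ _ (\esum_(w in [set: U * T]) (Q w * pmass W w.1)%:E)).
    apply: le_esum => w _; rewrite lee_fin.
    have [->|h] := eqVneq (pmass (fun o => (W o, X o)) w) 0.
      by rewrite mul0r mulr_ge0 ?pmass_ge0// ltW.
    by rewrite mulrC /r mulfVK.
  rewrite -(esum_prod (a := fun i j => (Q (i, j) * pmass W i)%:E)); last first.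
    by move=> i j; rewrite lee_fin mulr_ge0 ?pmass_ge0// ltW.
  rewrite -(esum_pmass1 W); apply: le_esum => u _; rewrite esum_finType; last first.
    by move=> j; rewrite lee_fin mulr_ge0 ?pmass_ge0// ltW.
  by rewrite sumEFin lee_fin -mulr_suml ler_piMl ?pmass_ge0.
have lNd : 0 <= ln (#|T|%:R / d).
  by rewrite ln_ge0// ler_pdivlMr// mul1r; lra.
have l1d : 0 <= - ln (1 - d) by rewrite oppr_ge0 ln_le0//; lra.
have B1 := bounded_mean_ratio (r := r \o (fun o => (W o, X o))) (fun=> r0 _) r1.
have B2 := bounded_mean_finite (fun o => X o == g (W o))
  (fun b => if b then - ln (1 - d) else - ln (1 - d) + ln (#|T|%:R / d)).
apply: (bounded_meanW _ _ (bounded_meanD B1 B2)).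
  rewrite add0r big_bool/=.
  have : pmass (fun o => X o == g (W o)) true + pmass (fun o => X o == g (W o)) false = 1.
    apply: EFin_inj; rewrite -(esum_pmass1 (fun o => X o == g (W o))).
    rewrite esum_finType => [|w]; last by rewrite lee_fin pmass_ge0.
    by rewrite big_bool/= EFinD.
  by move=> /(canRL (addKr _)) ->; lra.
move=> o Po /=.
have [w0 wx0] := conj (pmass_gt0 W Po) (pmass_gt0 (fun o => (W o, X o)) Po).
have rp : 0 < r (W o, X o) by rewrite /r/= !mulr_gt0 ?invr_gt0.
have -> : surprisal (fun o => (W o, X o)) o - surprisal W o =
  ln (r (W o, X o)) - ln (Q (W o, X o)).
  rewrite /surprisal /r/= !lnM ?posrE ?mulr_gt0 ?invr_gt0// !lnV ?posrE//.
  lra.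
apply: lerD; first by rewrite -[X in ln X](addrNK 1) addrC le_ln1Dx//; lra.
rewrite /Q/=; case: (_ == _) => //.
by rewrite -lnV ?posrE ?divr_gt0// invf_div; lra.
Qed.

Lemma esum_entropy {T} (W : Om -> T) :
  \esum_(w in [set: T]) (- (pmass W w * ln (pmass W w)))%:E = expect (surprisal W).
Proof.
rewrite -[RHS](esum_pmass W (F := fun w => - ln (pmass W w))).
  by apply: eq_esum => w _; rewrite mulrN.
by move=> w; rewrite oppr_ge0 ln_le0// pmass_le1.
Qed.

(** A finite set of outcomes carries mass more than 1 - e, and on it the finitely many thresholds
    have a maximum. *)
Lemma eventually_almost_sure (E : nat -> Om -> bool) :
  (forall o, 0 < P o -> exists t0, forall t, (t0 <= t)%N -> E t o) ->
  forall e, 0 < e -> exists t, 1 - pmass (E t) true <= e.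
Proof.
move=> Eev e e0.
have : (((1 - e)%:E) < \esum_(o in [set: Om]) (P o)%:E)%E.
  by rewrite P1 lte_fin; lra.
move=> /ereal_sup_gt[_ [X [finX _] <-]]; rewrite fsbig_finite//= => Xe.
have [t Et] : exists t, forall o, o \in fset_set X -> 0 < P o -> E t o.
  suff : forall s : seq Om, exists t0, forall t, (t0 <= t)%N ->
     forall o, o \in s -> 0 < P o -> E t o.
    by move=> /(_ (fset_set X))[t Ht]; exists t; apply: Ht.
  elim=> [|o s [t0 IH]]; first by exists 0%N.
  have [Po|Po] := ltP 0 (P o); last first.
    exists t0 => t t0t o'; rewrite inE => /predU1P[-> |]; last exact: IH.
    by rewrite ltNge Po.
  have [t1 Et1] := Eev _ Po; exists (maxn t0 t1) => t; rewrite geq_max => /andP[h0 h1] o'.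
  by rewrite inE => /predU1P[-> _|]; [exact: Et1|exact: IH].
exists t; suff : 1 - e <= pmass (E t) true by lra.
rewrite -lee_fin pmassE; apply: (le_trans (ltW Xe)).
rewrite esum_mkcond; apply: esum_ge; exists X => //.
rewrite fsbig_finite//= big_seq [leRHS]big_seq; apply: lee_sum => o oX.
have := P0 o; rewrite le_eqVlt => /predU1P[<-|Po]; first by case: ifP.
by rewrite mem_set//=; apply: Et.
Qed.

(** The kernel [phi] shows that the law of N given S depends on e(S) only, so S - e(S) - N is a
    Markov chain and H(N|S) = H(N|e(S)); the identity is stated pointwise and without
    subtractions. *)
Lemma conditional_independence {T U V} (S : Om -> T) (N : Om -> U) (e : T -> V)
    (phi : V -> U -> R) :
  (forall v n, 0 <= phi v n) ->
  (forall s n, pmass (fun o => (S o, N o)) (s, n) = pmass S s * phi (e s) n) ->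
  forall o, 0 < P o -> surprisal (fun o => (S o, N o)) o + surprisal (e \o S) o =
    surprisal S o + surprisal (fun o => (e (S o), N o)) o.
Proof.
move=> phi0 Sphi o Po.
(* Summing over a fibre of [e] leaves the same kernel. *)
have EN v n : pmass (fun o => (e (S o), N o)) (v, n) = pmass (e \o S) v * phi v n.
  apply: EFin_inj; rewrite pmassE (esum_fiber S)//.
  rewrite EFinM muleC (pmass_comp e S) -esumZl//; last first.
    by move=> s; rewrite lee_fin pmass_ge0.
  rewrite [RHS]esum_mkcond; apply: eq_esum => s _.
  case: ifPn => [/set_mem /= es|/negP es].
    rewrite -es -EFinM mulrC -Sphi pmassE; congr esum.
    by apply/seteqP; split => o' /= => [[[_ ->] ->]|[-> ->]].
  rewrite esum1// => o' /= [[eS _] So]; exfalso; apply: es; apply/mem_set => /=.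
  by rewrite -So.
have S0 := pmass_gt0 S Po; have e0 := pmass_gt0 (e \o S) Po.
have : 0 < phi (e (S o)) (N o).
  have := pmass_gt0 (fun o => (S o, N o)) Po.
  by rewrite Sphi pmulr_rgt0.
move=> p0; rewrite /surprisal Sphi EN /= !lnM ?posrE//.
by rewrite !opprD addrAC addrA.
Qed.

(* The density of I(A;B) - I(A;B|C), when S determines and is determined by
   (A,B,C). *)
Definition interaction {TA TB TC T} (A : Om -> TA) (B : Om -> TB) (C : Om -> TC)
    (S : Om -> T) (o : Om) : R :=
  surprisal A o + surprisal B o + surprisal C o + surprisal S o
  - surprisal (fun o => (A o, B o)) o - surprisal (fun o => (A o, C o)) o
  - surprisal (fun o => (B o, C o)) o.

Lemma surprisalC {T U} (A : Om -> T) (B : Om -> U) o :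
  surprisal (fun o => (A o, B o)) o = surprisal (fun o => (B o, A o)) o.
Proof. by apply: eq_surprisal => o' _; split => -[-> ->]. Qed.

Lemma interactionCA {TA TB TC T} (A : Om -> TA) (B : Om -> TB) (C : Om -> TC)
  (S : Om -> T) o : interaction A C B S o = interaction A B C S o.
Proof. by rewrite /interaction (surprisalC C B); lra. Qed.

Lemma interactionAC {TA TB TC T} (A : Om -> TA) (B : Om -> TB) (C : Om -> TC)
  (S : Om -> T) o : interaction B A C S o = interaction A B C S o.
Proof. by rewrite /interaction (surprisalC B A); lra. Qed.

Lemma eq_interaction {TA TB TC T} {TA' TB' TC' T' : choiceType}
    (A : Om -> TA) (B : Om -> TB) (C : Om -> TC) (S : Om -> T)
    (A' : Om -> TA') (B' : Om -> TB') (C' : Om -> TC') (S' : Om -> T') o :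
  (forall o', 0 < P o' -> A' o' = A' o <-> A o' = A o) ->
  (forall o', 0 < P o' -> B' o' = B' o <-> B o' = B o) ->
  (forall o', 0 < P o' -> C' o' = C' o <-> C o' = C o) ->
  (forall o', 0 < P o' -> S' o' = S' o <-> S o' = S o) ->
  interaction A B C S o = interaction A' B' C' S' o.
Proof.
move=> hA hB hC hS; rewrite /interaction.
rewrite (eq_surprisal hA) (eq_surprisal hB) (eq_surprisal hC) (eq_surprisal hS).
have pairE (T1 T2 T1' T2' : choiceType) (X : Om -> T1) (Y : Om -> T2) (X' : Om -> T1') (Y' : Om -> T2') :
    (forall o', 0 < P o' -> X' o' = X' o <-> X o' = X o) ->
    (forall o', 0 < P o' -> Y' o' = Y' o <-> Y o' = Y o) ->
    surprisal (fun o => (X o, Y o)) o = surprisal (fun o => (X' o, Y' o)) o.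
  move=> hX hY; apply: eq_surprisal => o' Po'; have [h1 h2] := hX _ Po'.
  have [h3 h4] := hY _ Po'; split => -[e1 e2].
    by rewrite h1 ?h3.
  by rewrite h2 ?h4.
by rewrite (pairE _ _ _ _ _ _ _ _ hA hB) (pairE _ _ _ _ _ _ _ _ hA hC)
  (pairE _ _ _ _ _ _ _ _ hB hC).
Qed.

(* The new messages [U] and [V] are independent of the passive link [B] given
   the links [A] and [C] of their sender, so that the interaction information
   grows by I(U;B|A) + I(V;B|C). *)
Lemma interaction_step {TA TB TC T TU TV} (A : Om -> TA) (B : Om -> TB)
    (C : Om -> TC) (S : Om -> T) (U : Om -> TU) (V : Om -> TV) :
  (forall o, 0 < P o ->
    surprisal (fun o => (S o, (U o, V o))) o + surprisal (fun o => (A o, C o)) o =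
    surprisal S o + surprisal (fun o => ((A o, C o), (U o, V o))) o) ->
  bounded_mean (fun o => - interaction A B C S o) 0 ->
  bounded_mean (fun o => - interaction (fun o => (A o, U o)) B
    (fun o => (C o, V o)) (fun o => (S o, (U o, V o))) o) 0.
Proof.
move=> CI bj.
have := bounded_meanD bj (bounded_meanD (submodularity B U A) (submodularity B V C)).
rewrite !addr0; apply: bounded_meanW => // o Po; have := CI o Po.
rewrite /interaction.
have -> : surprisal (fun o => ((A o, U o), B o)) o = surprisal (fun o => (A o, B o, U o)) o.
  by apply: eq_surprisal => o' _; split => -[-> -> ->].
have -> : surprisal (fun o => (B o, (C o, V o))) o = surprisal (fun o => (C o, B o, V o)) o.
  by apply: eq_surprisal => o' _; split => -[-> -> ->].
have -> : surprisal (fun o => ((A o, U o), (C o, V o))) o =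
    surprisal (fun o => ((A o, C o), (U o, V o))) o.
  by apply: eq_surprisal => o' _; split => -[-> -> -> ->].
rewrite (surprisalC C B); lra.
Qed.

End DiscreteProbability.

(** * Parsing transcripts *)

Lemma prefix_comparable (u v a b s : seq bool) :
  prefix (u ++ a) s -> prefix (v ++ b) s -> prefix u v \/ prefix v u.
Proof.
move=> /prefixP[a' ->] /prefixP[b']; rewrite -!catA => e.
have [uv|/ltnW vu] := leqP (size u) (size v).
  left; rewrite prefixE; apply/eqP.
  by have := congr1 (take (size u)) e; rewrite (take_size_cat _ erefl) takel_cat.
right; rewrite prefixE; apply/eqP.
by have := congr1 (take (size v)) e; rewrite (take_size_cat _ erefl) takel_cat.
Qed.

Lemma prefix_cat2 (u a b : seq bool) : prefix (u ++ a) (u ++ b) = prefix a b.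
Proof. by elim: u => //= x u IH; rewrite eqxx. Qed.

Lemma trans_cat (l l' : lhist) : trans (l ++ l') = trans l ++ trans l'.
Proof. by rewrite /trans map_cat flatten_cat. Qed.

Lemma trans_rcons (l : lhist) m : trans (rcons l m) = trans l ++ m.1 ++ m.2.
Proof. by rewrite -cats1 trans_cat /trans /= cats0. Qed.

Lemma prefix_trans_take k (l : lhist) : prefix (trans (take k l)) (trans l).
Proof. by rewrite -[in X in prefix _ X](cat_take_drop k l) trans_cat prefix_prefix. Qed.

Definition link_valid (c1 c2 : lhist -> msg -> bool) (l : lhist) : Prop :=
  forall k, (k < size l)%N ->
    c1 (take k l) (nth ([::], [::]) l k).1 && c2 (take k l) (nth ([::], [::]) l k).2.

Lemma link_valid_take c1 c2 k l : link_valid c1 c2 l -> link_valid c1 c2 (take k l).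
Proof.
move=> lv i; rewrite size_take_min leq_min => /andP[ik il].
by rewrite nth_take// take_takel ?(ltnW ik)//; apply: lv.
Qed.

Section Links.
Variables (c1 c2 : lhist -> msg -> bool).
Hypotheses (pf1 : forall l, prefix_free (c1 l)) (pf2 : forall l, prefix_free (c2 l)).

(** Induction from the last round. In it, two codewords of one prefix-free code both start the same
    remaining string, so they are comparable and hence equal, first in one direction and then in the
    other. Asking for prefixes of a common [s], not for equal transcripts, lets unfinished histories
    be compared with a final transcript. *)
Lemma parse_unique l l' s : size l = size l' ->
  link_valid c1 c2 l -> link_valid c1 c2 l' ->
  prefix (trans l) s -> prefix (trans l') s -> l = l'.
Proof.
elim/last_ind: l l' => [|l m IH] l'; first by case: l'.
case/lastP: l' => [|l' m']; first by rewrite size_rcons.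
rewrite !size_rcons => -[sz] v v' p p'.
have takeR (k : lhist) x : take (size k) (rcons k x) = k.
  by rewrite -cats1 take_size_cat.
(* The codes of the last round depend on the earlier rounds, so these have to agree first. *)
have ll' : l = l'.
  apply: IH => //.
  - by rewrite -(takeR l m); apply: link_valid_take.
  - by rewrite -(takeR l' m'); apply: link_valid_take.
  - by apply: prefix_trans p; rewrite trans_rcons prefix_prefix.
  - by apply: prefix_trans p'; rewrite trans_rcons prefix_prefix.
subst l'; congr rcons.
have := v (size l); have := v' (size l); rewrite !size_rcons ltnS leqnn.
rewrite !takeR !nth_rcons ltnn eqxx => /(_ isT)/andP[c1' c2'] /(_ isT)/andP[d1 d2].
move: p p'; rewrite !trans_rcons => /prefixP[r ->]; rewrite -[X in prefix _ X]catA prefix_cat2 => p'.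
have p := prefix_prefix (m.1 ++ m.2) r.
have m1 : m.1 = m'.1.
  case: (prefix_comparable p p') => h; first exact: (pf1 d1 c1' h).
  by have := pf1 c1' d1 h.
move: p p'; rewrite -!catA -m1 !prefix_cat2 => p p'.
have m2 : m.2 = m'.2.
  have := @prefix_comparable m.2 m'.2 [::] [::] (m.2 ++ r).
  rewrite !cats0 => /(_ p p')[] h; first exact: (pf2 d2 c2' h).
  by have := pf2 c2' d2 h.
by rewrite [m]surjective_pairing [m']surjective_pairing m1 m2.
Qed.

End Links.

Lemma links_inj (h h' : seq round) : lh12 h = lh12 h' -> lh23 h = lh23 h' ->
  lh31 h = lh31 h' -> h = h'.
Proof.
elim: h h' => [|r h IH] [|r' h']//= [e1 e2 e3] [e4 e5 e6] [e7 e8 e9].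
congr cons; last exact: IH.
move: r r' e1 e2 e4 e5 e7 e8 {e3 e6 e9} => [[[? ?] [? ?]] [? ?]] [[[? ?] [? ?]] [? ?]].
by rewrite /a2b /a2c /b2a /b2c /c2a /c2b/= => -> -> -> -> -> ->.
Qed.

(** * Probabilities of round histories *)

Section ProtocolLaws.
Context {R : realType} {TX TY TZ : finType} (pi : protocol R TX TY TZ).
Hypothesis piV : valid_protocol pi.
Implicit Types (h : seq round) (x : TX) (y : TY).

Definition hist_valid h : Prop :=
  [/\ link_valid (code_ab pi) (code_ba pi) (lh12 h),
      link_valid (code_bc pi) (code_cb pi) (lh23 h) &
      link_valid (code_ca pi) (code_ac pi) (lh31 h)].

Definition prefix3 (m m' : msg * msg * msg) : bool :=
  [&& prefix m.1.1 m'.1.1, prefix m.1.2 m'.1.2 & prefix m.2 m'.2].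

Lemma take_lh12 k h : lh12 (take k h) = take k (lh12 h).
Proof. exact: map_take. Qed.
Lemma take_lh23 k h : lh23 (take k h) = take k (lh23 h).
Proof. exact: map_take. Qed.
Lemma take_lh31 k h : lh31 (take k h) = take k (lh31 h).
Proof. exact: map_take. Qed.

Lemma hist_valid_take k h : hist_valid h -> hist_valid (take k h).
Proof.
case=> v1 v2 v3; rewrite /hist_valid take_lh12 take_lh23 take_lh31.
by split; apply: link_valid_take.
Qed.

Lemma prefix3_take k h : prefix3 (transcripts (take k h)) (transcripts h).
Proof.
by rewrite /prefix3/= take_lh12 take_lh23 take_lh31 !prefix_trans_take.
Qed.

Lemma prefix3_refl m : prefix3 m m.
Proof. by rewrite /prefix3 !prefix_refl. Qed.

Lemma prefix3_trans m m' m'' : prefix3 m m' -> prefix3 m' m'' -> prefix3 m m''.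
Proof.
move=> /and3P[a b c] /and3P[a' b' c'].
by rewrite /prefix3 (prefix_trans a) ?(prefix_trans b) ?(prefix_trans c).
Qed.

Lemma prefix3_anti m m' : prefix3 m m' -> prefix3 m' m -> m = m'.
Proof.
have anti (u v : msg) : prefix u v -> prefix v u -> u = v.
  move=> /prefixP[a ->] /prefixP[b]; rewrite -catA -[LHS]cats0.
  move=> /eqP; rewrite eqseq_cat ?eqxx//= => /eqP.
  by case: a => // _; rewrite cats0.
case: m m' => [[a b] c] [[a' b'] c'] /and3P[/= h1 h2 h3] /and3P[/= h4 h5 h6].
by rewrite (anti _ _ h1 h4) (anti _ _ h2 h5) (anti _ _ h3 h6).
Qed.

Lemma hist_unique h h' m : size h = size h' -> hist_valid h -> hist_valid h' ->
  prefix3 (transcripts h) m -> prefix3 (transcripts h') m -> h = h'.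
Proof.
move=> sz [v1 v2 v3] [v1' v2' v3'] /and3P[p1 p2 p3] /and3P[q1 q2 q3].
have [[f1 [f2 [f3 [f4 [f5 f6]]]]] _] := piV.
by apply: links_inj; [apply: (parse_unique f1 f2) v1 v1' p1 q1|
  apply: (parse_unique f3 f4) v2 v2' p2 q2|
  apply: (parse_unique f5 f6) v3 v3' p3 q3]; rewrite !size_map.
Qed.

Lemma alice_ge0 x l1 l3 m : 0 <= alice pi x l1 l3 m.
Proof. by have [_ [/(_ x l1 l3)[[]]]] := piV. Qed.
Lemma bob_ge0 y l1 l2 m : 0 <= bob pi y l1 l2 m.
Proof. by have [_ [_ [/(_ y l1 l2)[[]]]]] := piV. Qed.
Lemma charlie_ge0 l2 l3 m : 0 <= charlie pi l2 l3 m.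
Proof. by have [_ [_ [_ /(_ l2 l3)[[]]]]] := piV. Qed.

Lemma alice_sum x l1 l3 : \esum_(m in [set: msg * msg]) (alice pi x l1 l3 m)%:E = 1%E.
Proof. by have [_ [/(_ x l1 l3)[[]]]] := piV. Qed.
Lemma bob_sum y l1 l2 : \esum_(m in [set: msg * msg]) (bob pi y l1 l2 m)%:E = 1%E.
Proof. by have [_ [_ [/(_ y l1 l2)[[]]]]] := piV. Qed.
Lemma charlie_sum l2 l3 : \esum_(m in [set: msg * msg]) (charlie pi l2 l3 m)%:E = 1%E.
Proof. by have [_ [_ [_ /(_ l2 l3)[[]]]]] := piV. Qed.

Lemma step_prob_ge0 x y h r : 0 <= step_prob pi x y h r.
Proof. by rewrite !mulr_ge0 ?alice_ge0 ?bob_ge0 ?charlie_ge0. Qed.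

Lemma hist_prob_ge0 x y h : 0 <= hist_prob pi x y h.
Proof. by apply: prodr_ge0 => k _; apply: step_prob_ge0. Qed.

Lemma hist_prob_valid x y h : hist_prob pi x y h != 0 -> hist_valid h.
Proof.
move=> /prodf_neq0 h0.
have [_ [fa [fb fc]]] := piV.
have st k : (k < size h)%N -> step_prob pi x y (take k h) (nth round0 h k) != 0.
  by move=> kh; apply: (h0 (Ordinal kh)).
split=> k; rewrite size_map => kh; have := st _ kh; rewrite !mulf_eq0 !negb_or;
  rewrite (nth_map round0)// -map_take => /andP[/andP[a0 b0] c0].
- have /andP[-> _] := (fa _ _ _).2 _ a0.
  by have /andP[-> _] := (fb _ _ _).2 _ b0.
- have /andP[_ ->] := (fb _ _ _).2 _ b0.
  by have /andP[_ ->] := (fc _ _).2 _ c0.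
- have /andP[-> _] := (fc _ _).2 _ c0.
  by have /andP[_ ->] := (fa _ _ _).2 _ a0.
Qed.

Lemma hist_prob_nil x y : hist_prob pi x y [::] = 1.
Proof. by rewrite /hist_prob big_ord0. Qed.

Lemma hist_prob_rcons x y h r :
  hist_prob pi x y (rcons h r) = hist_prob pi x y h * step_prob pi x y h r.
Proof.
rewrite /hist_prob size_rcons big_ord_recr/= nth_rcons ltnn eqxx.
rewrite -cats1 take_size_cat//; congr (_ * _); apply: eq_bigr => k _.
by rewrite takel_cat ?(ltnW (ltn_ord k))// nth_cat ltn_ord.
Qed.

Lemma esum_rcons (Q : set (seq round)) (F : seq round -> \bar R) k :
  (forall h, (0 <= F h)%E) ->
  \esum_(h in [set h | size h = k.+1 /\ Q h]) F h =
  \esum_(h in [set h | size h = k]) \esum_(r in [set r | Q (rcons h r)]) F (rcons h r).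
Proof.
move=> F0; rewrite esum_esum//.
apply: reindex_esum; split.
- by move=> [h r] [/= <- q]; rewrite size_rcons.
- move=> [h r] [h' r'] _ _ /= e; have := e.
  by move=> /rcons_inj[-> ->].
- move=> h [/=]; case/lastP: h => // h r; rewrite size_rcons => -[sz] q.
  by exists (h, r).
Qed.

(** Given the history, the three parties draw independently, so rectangles have product
    probability. *)
Lemma step_prob_sum x y h (A B C : set (msg * msg)) :
  \esum_(r in [set r : round | [/\ A r.1.1, B r.1.2 & C r.2]]) (step_prob pi x y h r)%:E =
  ((\esum_(a in A) (alice pi x (lh12 h) (lh31 h) a)%:E) *
   (\esum_(b in B) (bob pi y (lh12 h) (lh23 h) b)%:E) *
   (\esum_(c in C) (charlie pi (lh23 h) (lh31 h) c)%:E))%E.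
Proof.
have sub1 (f : msg * msg -> R) (S : set (msg * msg)) : (forall m, 0 <= f m) ->
    \esum_(m in [set: msg * msg]) (f m)%:E = 1%E ->
    exists2 s : R, 0 <= s & \esum_(m in S) (f m)%:E = s%:E.
  move=> f0 f1; exists (fine (\esum_(m in S) (f m)%:E)).
    by rewrite fine_ge0// esum_ge0// => ? _; rewrite lee_fin.
  rewrite fineK// ge0_fin_numE ?esum_ge0//; last by move=> ? _; rewrite lee_fin.
  apply: (@le_lt_trans _ _ 1%E); rewrite ?ltry// -f1; by apply: le_esum_sub.
set al := alice pi _ _ _; set bo := bob pi _ _ _; set ch := charlie pi _ _.
have al0 m : 0 <= al m by apply: alice_ge0.
have bo0 m : 0 <= bo m by apply: bob_ge0.
have ch0 m : 0 <= ch m by apply: charlie_ge0.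
have [c c0 cE] := sub1 ch C ch0 (charlie_sum _ _).
have [b b0 bE] := sub1 bo B bo0 (bob_sum _ _ _).
have -> : [set r : round | [/\ A r.1.1, B r.1.2 & C r.2]] =
          (A `*`` (fun=> B)) `*`` (fun=> C).
  by apply/seteqP; split => -[[? ?] ?] /=; [case|case=> -[]].
rewrite -(@esum_esum _ _ _ _ (fun=> C) (fun ab c => (al ab.1 * bo ab.2 * ch c)%:E)); last first.
  by move=> i j _ _; rewrite lee_fin !mulr_ge0.
rewrite (eq_esum (b := fun ab => (c * (al ab.1 * bo ab.2))%:E)); last first.
  by move=> ab _; rewrite esum_EFinM ?mulr_ge0// cE mulrC EFinM muleC.
rewrite esum_EFinM//; last by move=> ab; rewrite mulr_ge0.
rewrite -(@esum_esum _ _ _ A (fun=> B) (fun a b => (al a * bo b)%:E)); last first.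
  by move=> i j _ _; rewrite lee_fin !mulr_ge0.
rewrite (eq_esum (b := fun a => (b * al a)%:E)); last first.
  by move=> a _; rewrite esum_EFinM// bE mulrC EFinM.
by rewrite esum_EFinM// cE bE muleC (muleC b%:E).
Qed.

Lemma step_prob_sumT x y h :
  \esum_(r in [set: round]) (step_prob pi x y h r)%:E = 1%E.
Proof.
have := step_prob_sum x y h setT setT setT.
rewrite alice_sum bob_sum charlie_sum !mule1 => <-; congr esum.
by apply/seteqP; split.
Qed.

(** Consistency in time: each further round has total mass 1. *)
Lemma hist_prob_extend x y h0 t : (size h0 <= t)%N ->
  \esum_(h in [set h | size h = t /\ take (size h0) h = h0]) (hist_prob pi x y h)%:E =
  (hist_prob pi x y h0)%:E.
Proof.
elim: t => [|t IH].
  rewrite leqn0 size_eq0 => /eqP ->; apply: (esum_eq1 (i0 := [::])) => //.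
    by rewrite lee_fin hist_prob_ge0.
  by move=> h [/size0nil ->].
rewrite leq_eqVlt => /predU1P[sz|]; last first.
  rewrite ltnS => sz; rewrite -(IH sz) esum_rcons; last first.
    by move=> h; rewrite lee_fin hist_prob_ge0.
  have -> : [set h | size h = t /\ take (size h0) h = h0] =
    [set h : seq round | size h = t] `&` [set h | take (size h0) h = h0] by [].
  rewrite esum_mkcondr; apply: eq_esum => h /= ht.
  have tr r : take (size h0) (rcons h r) = take (size h0) h.
    by rewrite -cats1 takel_cat// ht.
  case: ifPn => [/set_mem /= th|/negP th].
    have -> : [set r | take (size h0) (rcons h r) = h0] = [set: round].
      by apply/seteqP; split => // r _ /=; rewrite tr.
    under eq_esum do rewrite hist_prob_rcons.
    rewrite esum_EFinM ?hist_prob_ge0//; last by move=> r; apply: step_prob_ge0.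
    by rewrite step_prob_sumT mule1.
  rewrite esum1// => r /=; rewrite tr => th'; exfalso; apply: th; exact/mem_set.
apply: (esum_eq1 (i0 := h0)) => //.
- by rewrite lee_fin hist_prob_ge0.
- by rewrite /= take_size sz.
- by move=> h [/= ht]; rewrite sz -ht take_size.
Qed.

End ProtocolLaws.

Import numFieldNormedType.Exports.

(** * Law of the final transcripts *)

Section FinalLaw.
Context {R : realType} {TX TY TZ : finType} (pi : protocol R TX TY TZ).
Hypothesis piV : valid_protocol pi.
Implicit Types (h : seq round) (x : TX) (y : TY).

Lemma trans_prob_at_ge0 x y t m : (0 <= trans_prob_at pi x y t m)%E.
Proof. by apply: esum_ge0 => h _; rewrite lee_fin hist_prob_ge0. Qed.

(** At a fixed length at most one valid history has given transcripts, so the sum has a single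
    nonzero term. *)
Lemma trans_prob_at_valid x y h : hist_valid pi h ->
  trans_prob_at pi x y (size h) (transcripts h) = (hist_prob pi x y h)%:E.
Proof.
move=> hv; apply: (esum_eq1 (i0 := h)) => //; first by rewrite lee_fin hist_prob_ge0.
move=> h' [/= sz tr] h'h; apply/eqP; rewrite eqe; apply: contrapT => /negP /(hist_prob_valid piV) h'v.
apply: h'h; apply: (hist_unique piV (m := transcripts h)) => //; first by rewrite tr prefix3_refl.
exact: prefix3_refl.
Qed.

Lemma trans_prob_at_eq0 x y t m :
  (forall h, hist_valid pi h -> size h = t -> transcripts h = m ->
     hist_prob pi x y h = 0) ->
  trans_prob_at pi x y t m = 0%E.
Proof.
move=> h0; apply: esum1 => h [/= sz tr]; apply/eqP; rewrite eqe.
apply: contrapT => /negP hn; move: (hn); rewrite (h0 h) ?eqxx//.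
exact: (hist_prob_valid piV hn).
Qed.

Lemma step_prob_le1 x y h r : step_prob pi x y h r <= 1.
Proof.
rewrite -lee_fin -(step_prob_sumT piV x y h).
apply: (esum_ge1 (a := fun r => (step_prob pi x y h r)%:E)) => // r'.
by rewrite lee_fin step_prob_ge0.
Qed.

(** A history of length t+1 with the transcripts of [h] extends [h] by unique parsing, and its first
    t rounds have these transcripts too. The last round therefore only multiplies the probability by
    a factor at most 1. *)
Lemma trans_prob_at_nonincreasing x y h t : hist_valid pi h -> (size h <= t)%N ->
  (trans_prob_at pi x y t.+1 (transcripts h) <= trans_prob_at pi x y t (transcripts h))%E.
Proof.
move=> hv ht.
have [[h' [h'v sz tr]]|nh] := pselect (exists h', [/\ hist_valid pi h', size h' = t.+1 &
    transcripts h' = transcripts h]); last first.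
  rewrite trans_prob_at_eq0 ?trans_prob_at_ge0// => h' v sz tr.
  by exfalso; apply: nh; exists h'.
case/lastP: h' => // h' r in h'v sz tr *; move: (sz); rewrite size_rcons => -[sz'].
have tk s : (s <= t)%N -> take s (rcons h' r) = take s h'.
  by move=> st; rewrite -cats1 takel_cat// sz'.
have h'v' : hist_valid pi h'.
  by have := hist_valid_take t h'v; rewrite tk// -sz' take_size.
have eh : take (size h) h' = h.
  apply: (hist_unique piV (m := transcripts h)) => //.
  - by rewrite size_take_min sz'; apply/minn_idPl.
  - exact: hist_valid_take.
  - by rewrite -(tk _ ht) -tr prefix3_take.
  - exact: prefix3_refl.
have tr' : transcripts h' = transcripts h.
  apply: prefix3_anti; last by rewrite -eh prefix3_take.
  by have := prefix3_take t (rcons h' r); rewrite tk// -{1}sz' take_size tr.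
rewrite -[in leLHS]tr -[in leRHS]tr' -sz -[in leRHS]sz' !trans_prob_at_valid//.
rewrite lee_fin hist_prob_rcons ler_piMr ?hist_prob_ge0//.
exact: step_prob_le1.
Qed.

(** Gives content to the [limn] in [final_prob]: the sequence is nonincreasing from the length of
    some valid history with transcripts [m] on, and constantly 0 if there is none. *)
Lemma trans_prob_at_cvg x y m :
  (fun t => trans_prob_at pi x y t m) @ \oo --> final_prob pi x y m.
Proof.
rewrite /final_prob; set u := (fun t => _).
suff : cvgn u by [].
have [[h [hv tr]]|nh] := pselect (exists h, hist_valid pi h /\ transcripts h = m).
  suff /cvg_ex[l] : cvgn [sequence u (n + size h)%N]_n by rewrite cvg_shiftn => /cvgP.
  apply: ereal_nonincreasing_is_cvgn; apply/nonincreasing_seqP => n.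
  by rewrite /u/= -tr addSn trans_prob_at_nonincreasing// leq_addl.
have -> : u = fun=> 0%E; last exact: is_cvg_cst.
apply/funext => t; apply: trans_prob_at_eq0 => h hv _ tr.
by exfalso; apply: nh; exists h.
Qed.

Lemma final_prob_ge0 x y m : (0 <= final_prob pi x y m)%E.
Proof.
apply: lime_ge; first by apply/cvg_ex; exists (final_prob pi x y m); exact: trans_prob_at_cvg.
by apply: nearW => t; apply: trans_prob_at_ge0.
Qed.

(** Otherwise the probabilities would vanish from time [t] on, and so would their limit. *)
Lemma final_prob_history x y m t : final_prob pi x y m != 0%E ->
  exists h, [/\ (t <= size h)%N, hist_valid pi h & transcripts h = m].
Proof.
move=> m0; apply: contrapT => nh; move/eqP: m0; apply.
apply/cvg_lim => //; apply: cvg_near_cst; exists t => // s /= ts; apply: trans_prob_at_eq0 => h hv sz tr.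
by exfalso; apply: nh; exists h; rewrite sz.
Qed.

(* The first t rounds, recovered from the final transcripts m; this is [::] when
   m has probability zero and cannot be parsed. *)
Definition round_history t m : seq round := xget [::]
  [set h | [/\ size h = t, hist_valid pi h & prefix3 (transcripts h) m]].

Lemma round_historyE t m h : size h = t -> hist_valid pi h ->
  prefix3 (transcripts h) m -> round_history t m = h.
Proof.
move=> sz hv hm; rewrite /round_history; case: xgetP => [h' _ [sz' v' m']|].
  by apply: (hist_unique piV _ v' hv m' hm); rewrite sz sz'.
by move=> /(_ h) nh; exfalso; apply: nh.
Qed.

Lemma round_history_transcripts t h : hist_valid pi h -> (t <= size h)%N ->
  round_history t (transcripts h) = take t h.
Proof.
move=> hv th; apply: round_historyE; last exact: prefix3_take.
- by rewrite size_takel.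
- exact: hist_valid_take.
Qed.

Lemma round_historyP t x y m : final_prob pi x y m != 0%E ->
  [/\ size (round_history t m) = t, hist_valid pi (round_history t m) &
      prefix3 (transcripts (round_history t m)) m].
Proof.
move=> /(final_prob_history t)[h [th hv <-]].
rewrite round_history_transcripts//; split; last exact: prefix3_take.
- by rewrite size_takel.
- exact: hist_valid_take.
Qed.

Lemma round_history_final x y m : final_prob pi x y m != 0%E ->
  exists t0, forall t, (t0 <= t)%N -> transcripts (round_history t m) = m.
Proof.
move=> m0; have [h [_ hv tr]] := final_prob_history 0 m0.
exists (size h) => t ht; have [sz v pm] := round_historyP t m0.
apply: prefix3_anti => //; suff eh : take (size h) (round_history t m) = h.
  by rewrite -{1}tr -eh prefix3_take.
apply: (hist_unique piV (m := m)) => //.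
- by rewrite size_takel ?sz.
- exact: hist_valid_take.
- by apply: prefix3_trans pm; apply: prefix3_take.
- by rewrite -tr prefix3_refl.
Qed.

(** A Fatou argument: a finite set of transcripts is treated at a finite time s, where
    [hist_prob_extend] bounds its mass, and then s tends to infinity. Mass may escape in the limit,
    hence only an inequality at this stage. *)
Lemma round_history_law_le x y h :
  (\esum_(m in [set m | round_history (size h) m = h]) final_prob pi x y m <=
  (hist_prob pi x y h)%:E)%E.
Proof.
apply: ge_ereal_sup => _ [X [finX XS] <-]; rewrite fsbig_finite//=.
have hp0 h' : (0 <= (hist_prob pi x y h')%:E)%E by rewrite lee_fin hist_prob_ge0.
apply: (cvge_le (f := fun s => (\sum_(m <- fset_set X) trans_prob_at pi x y s m)%E)
  (F := \oo)); last first.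
  apply: (@cvg_nnesum _ _ _ _ _ _ (fun m s => trans_prob_at pi x y s m)) => m _.
    by apply: nearW => s; apply: trans_prob_at_ge0.
  exact: trans_prob_at_cvg.
exists (size h) => // s /= hs.
rewrite -fsbig_finite//.
apply: (@le_trans _ _ (\esum_(m in [set m | round_history (size h) m = h])
   trans_prob_at pi x y s m)); first by apply: ereal_sup_ubound; exists X.
apply: (@le_trans _ _ (\esum_(h' in [set h' | size h' = s /\
    round_history (size h) (transcripts h') = h]) (hist_prob pi x y h')%:E)).
  rewrite (esum_fiber transcripts [set h' | size h' = s /\ _])//.
  rewrite esum_mkcond; apply: le_esum => m _; case: ifPn => [/set_mem /= hm|_].
    by apply: le_esum_sub => // h' [/= sz tr]; rewrite tr.
  by apply: esum_ge0.
rewrite -(hist_prob_extend piV x y hs).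
rewrite esum_mkcond [leRHS]esum_mkcond; apply: le_esum => h' _.
case: ifPn => [/set_mem[/= sz rh]|_]; last by case: ifP.
have [->|h'0] := eqVneq (hist_prob pi x y h') 0; first by case: ifP.
rewrite mem_set//=; split => //.
by rewrite -round_history_transcripts ?sz//; apply: hist_prob_valid h'0.
Qed.

Hypothesis piT : terminates pi.

Definition law x y m : R := fine (final_prob pi x y m).

Lemma lawE x y m : (law x y m)%:E = final_prob pi x y m.
Proof.
rewrite fineK// ge0_fin_numE ?final_prob_ge0//.
apply: (@le_lt_trans _ _ 1%E); rewrite ?ltry// -(piT x y).
by apply: (esum_ge1 (a := fun m => final_prob pi x y m)) => //; apply: final_prob_ge0.
Qed.

Lemma law_ge0 x y m : 0 <= law x y m.
Proof. by rewrite -lee_fin lawE final_prob_ge0. Qed.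

Lemma law_sum x y : \esum_(m in [set: msg * msg * msg]) (law x y m)%:E = 1%E.
Proof. by rewrite -(piT x y); apply: eq_esum => m _; rewrite lawE. Qed.

Lemma law_neq0 x y m : 0 < law x y m -> final_prob pi x y m != 0%E.
Proof. by rewrite -lawE eqe => /gt_eqF ->. Qed.

(** Over the histories of length t both sides have total 1, the left by termination and the right by
    consistency, so the inequality [round_history_law_le] is an equality everywhere. *)
Lemma round_history_law x y h :
  \esum_(m in [set m | round_history (size h) m = h]) (law x y m)%:E =
  (hist_prob pi x y h)%:E.
Proof.
under eq_esum do rewrite lawE.
pose t := size h.
pose a h' := fine (\esum_(m in [set m | round_history t m = h']) final_prob pi x y m).
have s0 h' : (0 <= \esum_(m in [set m | round_history t m = h']) final_prob pi x y m)%E.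
  by apply: esum_ge0 => m _; apply: final_prob_ge0.
have aE h' : size h' = t ->
    (a h')%:E = \esum_(m in [set m | round_history t m = h']) final_prob pi x y m.
  move=> sz; rewrite fineK// ge0_fin_numE//.
  by have := round_history_law_le x y h'; rewrite sz => /le_lt_trans; apply; rewrite ltry.
rewrite -/t -aE//; congr (_%:E).
apply: (@eq_of_le_esum _ _ a (hist_prob pi x y) [set h' | size h' = t]) => //.
- move=> h' /= sz; rewrite -!lee_fin aE// s0/= -sz.
  exact: round_history_law_le.
- rewrite -(piT x y) (esum_fiber (round_history t)); last by move=> m; apply: final_prob_ge0.
  rewrite esum_mkcond; apply: eq_esum => h' _.
  case: ifPn => [/set_mem /= sz|/negP nsz].
    rewrite aE//; congr esum; apply/seteqP; split => m /=; by [split|case].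
  rewrite esum1// => m /= [_ mh']; apply/eqP; apply: contrapT => /negP m0.
  by apply: nsz; apply/mem_set => /=; rewrite -mh'; have [] := round_historyP t m0.
- have := hist_prob_extend piV x y (h0 := [::]) (leq0n t).
  rewrite hist_prob_nil => <-; congr esum; apply/seteqP.
  by split => h' /=; [rewrite take0|case].
Qed.

Lemma law_cvg x y m : (fun t => fine (trans_prob_at pi x y t m)) @ \oo --> law x y m.
Proof.
by apply: fine_cvg; rewrite lawE; exact: trans_prob_at_cvg.
Qed.

(** At each time the transcripts [m] and [m'] stem from at most one valid history each, so
    identities between history probabilities pass to the limit. *)
Lemma law_exchange x y x' y' x1 y1 x1' y1' m m' :
  (forall h h', hist_valid pi h -> hist_valid pi h' -> size h = size h' ->
    transcripts h = m -> transcripts h' = m' ->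
    hist_prob pi x y h * hist_prob pi x' y' h' =
    hist_prob pi x1 y1 h * hist_prob pi x1' y1' h') ->
  law x y m * law x' y' m' = law x1 y1 m * law x1' y1' m'.
Proof.
move=> hh.
have c a b a' b' : (fun t => fine (trans_prob_at pi a b t m) *
    fine (trans_prob_at pi a' b' t m')) @ \oo --> law a b m * law a' b' m'.
  by apply: cvgM; apply: law_cvg.
rewrite -(cvg_lim (@Rhausdorff R) (@c x y x' y')).
rewrite -(cvg_lim (@Rhausdorff R) (@c x1 y1 x1' y1')).
congr (lim (_ @ \oo)); apply/funext => t /=.
have [[h [hv sz tr]]|nh] := pselect (exists h, [/\ hist_valid pi h, size h = t &
    transcripts h = m]); last first.
  have z a b : trans_prob_at pi a b t m = 0%E.
    by apply: trans_prob_at_eq0 => h hv sz tr; exfalso; apply: nh; exists h.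
  by rewrite !z !mul0r.
have [[h' [hv' sz' tr']]|nh] := pselect (exists h, [/\ hist_valid pi h, size h = t &
    transcripts h = m']); last first.
  have z a b : trans_prob_at pi a b t m' = 0%E.
    by apply: trans_prob_at_eq0 => h' hv' sz' tr'; exfalso; apply: nh; exists h'.
  by rewrite !z !mulr0.
have zm a b : trans_prob_at pi a b t m = (hist_prob pi a b h)%:E.
  by rewrite -tr -sz trans_prob_at_valid.
have zm' a b : trans_prob_at pi a b t m' = (hist_prob pi a b h')%:E.
  by rewrite -tr' -sz' trans_prob_at_valid.
by rewrite !zm !zm' /= (hh h h')// sz.
Qed.

(** Alice's factor in the probability of a history. Link 31 lists Charlie's message first, so hers
    is the second component there. *)
Definition alice_weight x (l1 l3 : lhist) : R := \prod_(k < size l1)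
  alice pi x (take k l1) (take k l3)
    ((nth ([::], [::]) l1 k).1, (nth ([::], [::]) l3 k).2).
Definition bob_weight y (l1 l2 : lhist) : R := \prod_(k < size l1)
  bob pi y (take k l1) (take k l2)
    ((nth ([::], [::]) l1 k).2, (nth ([::], [::]) l2 k).1).
Definition charlie_weight (l2 l3 : lhist) : R := \prod_(k < size l2)
  charlie pi (take k l2) (take k l3)
    ((nth ([::], [::]) l3 k).1, (nth ([::], [::]) l2 k).2).

(** The rectangle property of interactive protocols: each input enters through one factor, which
    sees only the links of its owner. *)
Lemma hist_probE x y h : hist_prob pi x y h =
  alice_weight x (lh12 h) (lh31 h) * bob_weight y (lh12 h) (lh23 h) *
  charlie_weight (lh23 h) (lh31 h).
Proof.
rewrite /hist_prob /alice_weight /bob_weight /charlie_weight !size_map -!big_split/=.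
apply: eq_bigr => k _; rewrite /step_prob !(nth_map round0)// -!map_take.
rewrite /a2b /b2a /b2c /c2b /c2a /a2c/=.
by case: (nth _ _ _) => [[[? ?] [? ?]] [? ?]].
Qed.

(** Cut and paste: the two histories agree on Alice's links, so her factors are the same functions
    of the input and can be swapped. *)
Lemma law_exchange_alice x x' y m m' : m.1.1 = m'.1.1 -> m.2 = m'.2 ->
  law x y m * law x' y m' = law x' y m * law x y m'.
Proof.
move=> e1 e3; apply: law_exchange => h h' hv hv' sz tr tr'.
have [[f1 [f2 [f3 [f4 [f5 f6]]]]] _] := piV.
have [v1 v2 v3] := hv; have [v1' v2' v3'] := hv'.
have -> : lh12 h' = lh12 h -> lh31 h' = lh31 h -> 
    hist_prob pi x y h * hist_prob pi x' y h' =
    hist_prob pi x' y h * hist_prob pi x y h'.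
  by move=> l1 l3; rewrite !hist_probE l1 l3; ring.
- by [].
- symmetry; apply: (parse_unique f1 f2 (s := m.1.1)) => //; rewrite ?size_map//.
    by rewrite -tr prefix_refl.
  by rewrite e1 -tr' prefix_refl.
- symmetry; apply: (parse_unique f5 f6 (s := m.2)) => //; rewrite ?size_map//.
    by rewrite -tr prefix_refl.
  by rewrite e3 -tr' prefix_refl.
Qed.

Lemma law_exchange_bob x y y' m m' : m.1 = m'.1 ->
  law x y m * law x y' m' = law x y' m * law x y m'.
Proof.
move=> e1; apply: law_exchange => h h' hv hv' sz tr tr'.
have [[f1 [f2 [f3 [f4 [f5 f6]]]]] _] := piV.
have [v1 v2 v3] := hv; have [v1' v2' v3'] := hv'.
have -> : lh12 h' = lh12 h -> lh23 h' = lh23 h -> 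
    hist_prob pi x y h * hist_prob pi x y' h' =
    hist_prob pi x y' h * hist_prob pi x y h'.
  by move=> l1 l2; rewrite !hist_probE l1 l2; ring.
- by [].
- symmetry; apply: (parse_unique f1 f2 (s := m.1.1)) => //; rewrite ?size_map//.
    by rewrite -tr prefix_refl.
  by rewrite e1 -tr' prefix_refl.
- symmetry; apply: (parse_unique f3 f4 (s := m.1.2)) => //; rewrite ?size_map//.
    by rewrite -tr prefix_refl.
  by rewrite e1 -tr' prefix_refl.
Qed.

End FinalLaw.

(** * Joint law of the inputs and the final transcripts *)

Section InputLaw.
Context {R : realType} {TX TY TZ : finType} (pi : protocol R TX TY TZ).
Hypotheses (piV : valid_protocol pi) (piT : terminates pi).

Definition input_dist (p : TX -> TY -> R) : Prop :=
  (forall x y, 0 <= p x y) /\ \sum_(xy : TX * TY) p xy.1 xy.2 = 1.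

(** The input distribution is kept separate from the one in the security hypothesis, since entropies
    of transcripts are later computed under other inputs. *)
Definition input_law (p : TX -> TY -> R) (o : Omega TX TY) : R :=
  p o.1.1 o.1.2 * law pi o.1.1 o.1.2 o.2.

Let law0 x y m : 0 <= law pi x y m := law_ge0 piV piT x y m.

Lemma joint_input_law p : joint p pi = (fun o => (input_law p o)%:E).
Proof. by apply/funext => o; rewrite /joint /input_law EFinM lawE. Qed.

Section Distribution.
Variable p : TX -> TY -> R.
Hypothesis pD : input_dist p.

Let p0 x y : 0 <= p x y. Proof. by case: pD. Qed.

Lemma input_law_ge0 o : 0 <= input_law p o.
Proof. by rewrite mulr_ge0. Qed.

Lemma input_law_gt0 x y m : 0 < p x y -> 0 < law pi x y m -> 0 < input_law p ((x, y), m).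
Proof. by move=> ? ?; apply: mulr_gt0. Qed.

Lemma input_law_gt0P o : 0 < input_law p o -> 0 < p o.1.1 o.1.2 /\ 0 < law pi o.1.1 o.1.2 o.2.
Proof.
rewrite /input_law => h.
have l0 : law pi o.1.1 o.1.2 o.2 != 0 by apply: contraL h => /eqP ->; rewrite mulr0 ltxx.
have p0' : p o.1.1 o.1.2 != 0 by apply: contraL h => /eqP ->; rewrite mul0r ltxx.
by rewrite !lt_neqAle eq_sym p0' eq_sym l0 p0 law0.
Qed.

Lemma input_law_esum (S : set (Omega TX TY)) :
  \esum_(o in S) (input_law p o)%:E =
  (\sum_(xy : TX * TY) (p xy.1 xy.2)%:E *
     \esum_(m in [set m | S (xy, m)]) (law pi xy.1 xy.2 m)%:E)%E.
Proof.
have -> : S = [set: TX * TY] `*`` (fun xy => [set m | S (xy, m)]).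
  by apply/seteqP; split => -[xy m] //= -[].
rewrite -(@esum_esum _ _ _ _ _ (fun xy m => (input_law p (xy, m))%:E)); last first.
  by move=> i j _ _; rewrite lee_fin input_law_ge0.
rewrite esum_finType; last by move=> i; apply: esum_ge0 => m _; rewrite lee_fin input_law_ge0.
apply: eq_bigr => xy _; rewrite /input_law/= esum_EFinM//; congr (_ * esum _ _)%E.
by apply/seteqP; split => m //= [].
Qed.

Lemma input_law_sum : \esum_(o in [set: Omega TX TY]) (input_law p o)%:E = 1%E.
Proof.
rewrite input_law_esum; have [_ <-] := pD; rewrite -sumEFin.
by apply: eq_bigr => xy _; rewrite law_sum// mule1.
Qed.

Lemma input_law_pair {T : choiceType} (W : msg * msg * msg -> T) w xy :
  pmass (input_law p) (fun o => (W o.2, o.1)) (w, xy) =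
  p xy.1 xy.2 * pmass (law pi xy.1 xy.2) W w.
Proof.
apply: EFin_inj; rewrite (pmassE input_law_ge0 input_law_sum) input_law_esum.
rewrite (bigD1 xy)//= big1 ?adde0 => [|xy' ne].
  rewrite EFinM (pmassE (law0 _ _) (law_sum piV piT _ _)); congr (_ * esum _ _)%E.
  by apply/seteqP; split => m /= => [[]|->].
rewrite esum1 ?mule0// => m /= [_ e]; by rewrite e eqxx in ne.
Qed.

Lemma input_law_input xy : pmass (input_law p) fst xy = p xy.1 xy.2.
Proof.
have := input_law_pair (fun=> tt) tt xy.
have -> : pmass (law pi xy.1 xy.2) (fun=> tt) tt = 1.
  apply: EFin_inj; rewrite (pmassE (law0 _ _) (law_sum piV piT _ _)).
  rewrite -(law_sum piV piT xy.1 xy.2); congr esum.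
  by apply/seteqP; split.
rewrite mulr1 => <-; apply: (eq_pmass input_law_ge0 input_law_sum) => o _.
by split => [<-|[]].
Qed.

Lemma pmass_input_law {T : choiceType} (W : msg * msg * msg -> T) w q :
  (forall x y, pmass (law pi x y) W w = q) ->
  pmass (input_law p) (fun o => W o.2) w = q.
Proof.
move=> Wq; apply: EFin_inj.
rewrite -(pmass_pair input_law_ge0 input_law_sum (fun o => W o.2) fst).
rewrite esum_finType => [|xy]; last first.
  by rewrite lee_fin (pmass_ge0 input_law_ge0 input_law_sum).
under eq_bigr do rewrite input_law_pair Wq.
by rewrite sumEFin -mulr_suml; have [_ ->] := pD; rewrite mul1r.
Qed.

(** As (b,c) determines the inputs, the Markov identity at an input pair reads p(x,y) P(a|x,y) P(b)
    = P(a,b) p(x,y). Full support allows cancelling p(x,y), so privacy becomes a statement about the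
    protocol alone, free of the input distribution. *)
Lemma markov_law {TA TB TC : choiceType} (A : msg * msg * msg -> TA)
    (B : Omega TX TY -> TB) (C : Omega TX TY -> TC)
    (b : TX -> TY -> TB) (c : TX -> TY -> TC) :
  (forall x y, 0 < p x y) ->
  (forall x y m, 0 < law pi x y m -> B (x, y, m) = b x y /\ C (x, y, m) = c x y) ->
  (forall x y x' y', b x y = b x' y' -> c x y = c x' y' -> (x, y) = (x', y')) ->
  markov (joint p pi) (fun w => A w.2) B C ->
  forall x y x' y' a, b x y = b x' y' ->
    pmass (law pi x y) A a = pmass (law pi x' y') A a.
Proof.
move=> pp bc bc_inj mk.
have key x y a : pmass (law pi x y) A a * pmass (input_law p) B (b x y) =
    pmass (input_law p) (fun o => (A o.2, B o)) (a, b x y).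
  have := mk a (b x y) (c x y); rewrite joint_input_law.
  rewrite /pmfRV -!(pmassE input_law_ge0 input_law_sum) -!EFinM => -[].
  have -> : pmass (input_law p) (fun o => (A o.2, B o, C o)) (a, b x y, c x y) =
      p x y * pmass (law pi x y) A a.
    rewrite -(input_law_pair A a (x, y)).
    apply: (eq_pmass input_law_ge0 input_law_sum) => -[[x' y'] m] /input_law_gt0P/= [_ l].
    have [-> ->] := bc _ _ _ l.
    by split => [[-> e1 e2]|[-> -> ->]//]; rewrite (bc_inj _ _ _ _ e1 e2).
  have -> : pmass (input_law p) (fun o => (B o, C o)) (b x y, c x y) = p x y.
    rewrite -(input_law_input (x, y)).
    apply: (eq_pmass input_law_ge0 input_law_sum) => -[[x' y'] m] /input_law_gt0P/= [_ l].
    have [-> ->] := bc _ _ _ l.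
    by split => [[e1 e2]|[-> ->]//]; rewrite (bc_inj _ _ _ _ e1 e2).
  rewrite -mulrA [RHS]mulrC; apply: mulfI; rewrite gt_eqF//.
move=> x y x' y' a bb; apply: (mulIf (x := pmass (input_law p) B (b x y))); last first.
  by rewrite key bb -key.
rewrite gt_eqF//; have [m l] := support_nonempty (law0 x y) (law_sum piV piT x y).
have [<- _] := bc _ _ _ l.
by apply: (pmass_gt0 input_law_ge0 input_law_sum); apply: input_law_gt0.
Qed.

End Distribution.

Lemma pmass_law_comp {T U : choiceType} (g : T -> U) (W : msg * msg * msg -> T) x y x' y' :
  (forall w, pmass (law pi x y) W w = pmass (law pi x' y') W w) ->
  forall u, pmass (law pi x y) (g \o W) u = pmass (law pi x' y') (g \o W) u.
Proof.
move=> WW u; apply: EFin_inj.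
rewrite (pmass_comp (law0 _ _) (law_sum piV piT _ _)).
rewrite (pmass_comp (law0 _ _) (law_sum piV piT _ _)).
by apply: eq_esum => w _; rewrite WW.
Qed.

(** A transcript whose law is the same for all inputs keeps that law under every mixture of
    inputs. *)
Lemma expect_surprisal_law {T : choiceType} (W : msg * msg * msg -> T) p p' :
  input_dist p -> input_dist p' ->
  (forall x y x' y' w, pmass (law pi x y) W w = pmass (law pi x' y') W w) ->
  expect (input_law p) (surprisal (input_law p) (fun o => W o.2)) =
  expect (input_law p') (surprisal (input_law p') (fun o => W o.2)).
Proof.
move=> pD pD' WW.
rewrite -(esum_entropy (input_law_ge0 pD) (input_law_sum pD)).
rewrite -(esum_entropy (input_law_ge0 pD') (input_law_sum pD')).
apply: eq_esum => w _.
have [o _] := support_nonempty (input_law_ge0 pD) (input_law_sum pD).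
by rewrite !(@pmass_input_law _ _ _ _ _ (pmass (law pi o.1.1 o.1.2) W w)).
Qed.

Lemma surprisal_input_indep {T V : choiceType} (W : msg * msg * msg -> T) (g : TX * TY -> V)
    (q : TX -> TY -> R) : input_dist q ->
  (forall x y x' y' w, pmass (law pi x y) W w = pmass (law pi x' y') W w) ->
  forall o, 0 < input_law q o ->
  surprisal (input_law q) (fun o => (g o.1, W o.2)) o =
  surprisal (input_law q) (fun o => g o.1) o +
  surprisal (input_law q) (fun o => W o.2) o.
Proof.
move=> qD WW o Po.
have P0 := input_law_ge0 qD; have P1 := input_law_sum qD.
have CI (V' : choiceType) (g' : TX * TY -> V') :=
  @conditional_independence _ _ _ P0 P1 _ _ _ fst (fun o => W o.2) g'
    (fun _ w => pmass (law pi o.1.1 o.1.2) W w).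
have {}CI (V' : choiceType) (g' : TX * TY -> V') :
   surprisal (input_law q) (fun o => (o.1, W o.2)) o +
   surprisal (input_law q) (fun o => g' o.1) o =
   surprisal (input_law q) fst o +
   surprisal (input_law q) (fun o => (g' o.1, W o.2)) o.
  apply: CI => // [_ w|xy w]; first exact: (pmass_ge0 (law_ge0 piV piT _ _) (law_sum piV piT _ _)).
  rewrite (input_law_input qD) (WW _ _ xy.1 xy.2).
  rewrite -(input_law_pair qD).
  by apply: (eq_pmass P0 P1) => o' _; split => -[-> ->].
(* The constant function gives independence from the whole input pair; comparison with the instance
   for [g] transfers it to [g]. *)
have := CI _ (fun=> tt); have := CI _ g.
have -> : surprisal (input_law q) (fun o => (tt, W o.2)) o =
          surprisal (input_law q) (fun o => W o.2) o.
  by apply: (eq_surprisal P0 P1) => o' _; split => [->|[->]].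
have -> : surprisal (input_law q) (fun=> tt) o = 0.
  rewrite /surprisal; have -> : pmass (input_law q) (fun=> tt) tt = 1.
    apply: EFin_inj; rewrite (pmassE P0 P1) -P1; congr esum.
    by apply/seteqP; split.
  by rewrite ln1 oppr0.
lra.
Qed.

End InputLaw.

(** * Entropy in bits as expected surprisal *)

Section EntropyOfDefs.
Context {R : realType}.

Lemma entropyE {Om T : choiceType} (P : Om -> R) (W : Om -> T) :
  (forall o, 0 <= P o) -> \esum_(o in [set: Om]) (P o)%:E = 1%E ->
  entropy (fun o => (P o)%:E) W = ((ln 2)^-1%:E * expect P (surprisal P W))%E.
Proof.
move=> P0 P1; rewrite -esum_entropy// -esum_EFinM.
- by apply: eq_esum => w _ /=; rewrite /log2 -/(pmass P W w) mulrN mulrA mulrC.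
- by rewrite invr_ge0 ln_ge0// ler1n.
- move=> w; rewrite oppr_ge0 mulr_ge0_le0 ?pmass_ge0//.
  by rewrite ln_le0// pmass_le1.
Qed.

End EntropyOfDefs.

(** * Interaction information along the rounds *)

Section Rounds.
Context {R : realType} {TX TY TZ : finType} (pi : protocol R TX TY TZ).
Hypotheses (piV : valid_protocol pi) (piT : terminates pi).

Definition next_round k m : round := last round0 (round_history pi k.+1 m).

Lemma round_history_rcons x y k m : 0 < law pi x y m ->
  round_history pi k.+1 m = rcons (round_history pi k m) (next_round k m).
Proof.
move=> l; have [sz v pm] := round_historyP piV k.+1 (law_neq0 piV piT l).
have e : round_history pi k m = take k (round_history pi k.+1 m).
  apply: round_historyE => //; first by rewrite size_takel ?sz.
    exact: hist_valid_take.
  by apply: prefix3_trans pm; apply: prefix3_take.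
rewrite e /next_round; case/lastP: (round_history pi k.+1 m) sz => // h r.
by rewrite size_rcons last_rcons => -[<-]; rewrite -cats1 take_size_cat// cats1.
Qed.

(** A history followed by a given round is again a history, so [round_history_law] applies to each
    value of the next round in [Q]. *)
Lemma law_step x y h (Q : set round) :
  \esum_(m in [set m | round_history pi (size h) m = h /\ Q (next_round (size h) m)])
    (law pi x y m)%:E =
  ((hist_prob pi x y h)%:E * \esum_(r in Q) (step_prob pi x y h r)%:E)%E.
Proof.
have l0 m : (0 <= (law pi x y m)%:E)%E by rewrite lee_fin law_ge0.
rewrite -esum_EFinM ?hist_prob_ge0//; last by move=> r; apply: step_prob_ge0.
rewrite (esum_fiber (next_round (size h)))// [RHS]esum_mkcond.
apply: eq_esum => r _; case: ifPn => [/set_mem Qr|/negP nQr]; last first.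
  by rewrite esum1// => m /= [[_ Qm] e]; exfalso; apply: nQr; apply/mem_set; rewrite -e.
rewrite -hist_prob_rcons -(round_history_law piV piT) size_rcons.
rewrite esum_mkcond [RHS]esum_mkcond; apply: eq_esum => m _.
have := l0 m; rewrite lee_fin le_eqVlt => /predU1P[<-|l].
  by case: ifP; case: ifP.
have e := round_history_rcons (size h) l.
case: ifPn => [/set_mem /= [[e1 _] e2]|/negP n].
  by rewrite mem_set//= e e1 e2.
rewrite memNset//= e => /rcons_inj[e1 e2]; apply: n; apply/mem_set => /=.
by rewrite e1 e2.
Qed.

Section ProductInput.
Variables (al : TX -> R) (be : TY -> R).
Hypotheses (al0 : forall x, 0 <= al x) (be0 : forall y, 0 <= be y).
Let p x y := al x * be y.
Hypothesis pD : input_dist p.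
Let P := input_law pi p.
Let P0 : forall o, 0 <= P o := input_law_ge0 piV piT pD.
Let P1 := input_law_sum piV piT pD.

Let S k (o : Omega TX TY) := round_history pi k o.2.
(** Explicit pairs, so that they are convertible to the form [(U o, V o)] of [interaction_step]. *)
Let a k (o : Omega TX TY) := ((next_round k o.2).1.1.1, (next_round k o.2).1.1.2).
Let b k (o : Omega TX TY) := ((next_round k o.2).1.2.1, (next_round k o.2).1.2.2).
Let c k (o : Omega TX TY) := ((next_round k o.2).2.1, (next_round k o.2).2.2).

(** Weights with the inputs summed out; under a product distribution the sums over x and y
    separate. *)
Let wA l1 l3 := \sum_x al x * alice_weight pi x l1 l3.
Let wB l1 l2 := \sum_y be y * bob_weight pi y l1 l2.
Let wAa l1 l3 u := \sum_x al x * alice_weight pi x l1 l3 * alice pi x l1 l3 u.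
Let wBb l1 l2 u := \sum_y be y * bob_weight pi y l1 l2 * bob pi y l1 l2 u.

Let mass_step h (Q : set round) (F : TX -> TY -> R) :
  (forall x y, \esum_(r in Q) (step_prob pi x y h r)%:E = (F x y)%:E) ->
  \esum_(o in [set o | S (size h) o = h /\ Q (next_round (size h) o.2)]) (P o)%:E =
  (\sum_x \sum_y al x * be y * (hist_prob pi x y h * F x y))%:E.
Proof.
move=> QF; rewrite (input_law_esum piV piT pD) pair_big/= -sumEFin.
by apply: eq_bigr => xy _; rewrite law_step QF -!EFinM.
Qed.

Let sum_split (f : TX -> R) (g : TY -> R) (w : R) (F : TX -> TY -> R) :
  (forall x y, F x y = f x * g y * w) ->
  \sum_x \sum_y F x y = (\sum_x f x) * (\sum_y g y) * w.
Proof.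
move=> Ffg; rewrite big_distrlr/= mulr_suml; apply: eq_bigr => x _.
by rewrite mulr_suml; apply: eq_bigr => y _; rewrite Ffg.
Qed.

Let size_S k o : 0 < P o -> size (S k o) = k.
Proof.
move=> /(input_law_gt0P piV piT pD)[_ l].
by have [] := round_historyP piV k (law_neq0 piV piT l).
Qed.

Let massS h : pmass P (S (size h)) h =
  wA (lh12 h) (lh31 h) * wB (lh12 h) (lh23 h) * charlie_weight pi (lh23 h) (lh31 h).
Proof.
apply: EFin_inj; rewrite (pmassE P0 P1).
have := @mass_step h setT (fun _ _ => 1) (fun x y => step_prob_sumT piV x y h).
have -> : [set o | S (size h) o = h /\ [set: round] (next_round (size h) o.2)] =
   [set o | S (size h) o = h] by apply/seteqP; split => o /= => [[]|].
move=> ->; congr (_%:E); apply: sum_split => x y; rewrite hist_probE; ring.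
Qed.

Let massA h u : pmass P (fun o => (S (size h) o, a (size h) o)) (h, u) =
  wAa (lh12 h) (lh31 h) u * wB (lh12 h) (lh23 h) * charlie_weight pi (lh23 h) (lh31 h).
Proof.
apply: EFin_inj; rewrite (pmassE P0 P1).
have -> : [set o | (S (size h) o, a (size h) o) = (h, u)] =
   [set o | S (size h) o = h /\ [set r : round |
     [/\ [set u] r.1.1, setT r.1.2 & setT r.2]] (next_round (size h) o.2)].
  by apply/seteqP; split => o /= => [[-> <-]|[-> [<- _ _]]]; rewrite /a -?surjective_pairing.
rewrite (mass_step (F := fun x y => alice pi x (lh12 h) (lh31 h) u)) => [|x y].
  congr (_%:E); apply: sum_split => x y; rewrite hist_probE; ring.
rewrite step_prob_sum// bob_sum// charlie_sum// !mule1 esum_set1//.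
by rewrite lee_fin alice_ge0.
Qed.

Let massB h u v : pmass P (fun o => ((S (size h) o, a (size h) o), b (size h) o)) ((h, u), v) =
  wAa (lh12 h) (lh31 h) u * wBb (lh12 h) (lh23 h) v * charlie_weight pi (lh23 h) (lh31 h).
Proof.
apply: EFin_inj; rewrite (pmassE P0 P1).
have -> : [set o | ((S (size h) o, a (size h) o), b (size h) o) = ((h, u), v)] =
   [set o | S (size h) o = h /\ [set r : round |
     [/\ [set u] r.1.1, [set v] r.1.2 & setT r.2]] (next_round (size h) o.2)].
  by apply/seteqP; split => o /= => [[-> <- <-]|[-> [<- <- _]]]; rewrite /a /b -?surjective_pairing.
rewrite (mass_step (F := fun x y => alice pi x (lh12 h) (lh31 h) u * bob pi y (lh12 h) (lh23 h) v)) => [|x y].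
  congr (_%:E); apply: sum_split => x y; rewrite hist_probE; ring.
rewrite step_prob_sum// charlie_sum// mule1 !esum_set1//.
  by rewrite lee_fin bob_ge0.
by rewrite lee_fin alice_ge0.
Qed.

Let massC h u v w : pmass P (fun o => ((S (size h) o, a (size h) o), b (size h) o, c (size h) o))
    ((h, u), v, w) =
  wAa (lh12 h) (lh31 h) u * wBb (lh12 h) (lh23 h) v * 
    (charlie_weight pi (lh23 h) (lh31 h) * charlie pi (lh23 h) (lh31 h) w).
Proof.
apply: EFin_inj; rewrite (pmassE P0 P1).
have -> : [set o | ((S (size h) o, a (size h) o), b (size h) o, c (size h) o) = ((h, u), v, w)] =
   [set o | S (size h) o = h /\ [set r : round |
     [/\ [set u] r.1.1, [set v] r.1.2 & [set w] r.2]] (next_round (size h) o.2)].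
  by apply/seteqP; split => o /= => [[-> <- <- <-]|[-> [<- <- <-]]];
    rewrite /a /b /c -?surjective_pairing.
rewrite (mass_step (F := fun x y => alice pi x (lh12 h) (lh31 h) u *
   bob pi y (lh12 h) (lh23 h) v * charlie pi (lh23 h) (lh31 h) w)) => [|x y].
  congr (_%:E); apply: sum_split => x y; rewrite hist_probE; ring.
rewrite step_prob_sum// !esum_set1//.
- by rewrite lee_fin charlie_ge0.
- by rewrite lee_fin bob_ge0.
- by rewrite lee_fin alice_ge0.
Qed.

Let alice_weight_ge0 x l1 l3 : 0 <= alice_weight pi x l1 l3.
Proof. by apply: prodr_ge0 => *; apply: alice_ge0. Qed.
Let bob_weight_ge0 y l1 l2 : 0 <= bob_weight pi y l1 l2.
Proof. by apply: prodr_ge0 => *; apply: bob_ge0. Qed.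

Let wA_ge0 l1 l3 : 0 <= wA l1 l3.
Proof. by apply: sumr_ge0 => x _; rewrite mulr_ge0. Qed.
Let wB_ge0 l1 l2 : 0 <= wB l1 l2.
Proof. by apply: sumr_ge0 => y _; rewrite mulr_ge0. Qed.
Let wAa_ge0 l1 l3 u : 0 <= wAa l1 l3 u.
Proof. by apply: sumr_ge0 => x _; rewrite !mulr_ge0// alice_ge0. Qed.
Let wBb_ge0 l1 l2 u : 0 <= wBb l1 l2 u.
Proof. by apply: sumr_ge0 => y _; rewrite !mulr_ge0// bob_ge0. Qed.

(** The quotient is the conditional pmf of Alice's next messages given her links; where [wA]
    vanishes, every term of [wAa] does as well. *)
Let wAaE l1 l3 u : wA l1 l3 * (wAa l1 l3 u / wA l1 l3) = wAa l1 l3 u.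
Proof.
have [e|ne] := eqVneq (wA l1 l3) 0; last by rewrite mulrC divfK.
have z x : al x * alice_weight pi x l1 l3 = 0.
  by apply/eqP; move/eqP: e; rewrite psumr_eq0 => [/allP/(_ x)|i _]; rewrite ?mem_index_enum ?mulr_ge0//; apply.
by rewrite e mul0r /wAa big1// => x _; rewrite z mul0r.
Qed.

Let wBbE l1 l2 u : wB l1 l2 * (wBb l1 l2 u / wB l1 l2) = wBb l1 l2 u.
Proof.
have [e|ne] := eqVneq (wB l1 l2) 0; last by rewrite mulrC divfK.
have z y : be y * bob_weight pi y l1 l2 = 0.
  by apply/eqP; move/eqP: e; rewrite psumr_eq0 => [/allP/(_ y)|i _]; rewrite ?mem_index_enum ?mulr_ge0//; apply.
by rewrite e mul0r /wBb big1// => y _; rewrite z mul0r.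
Qed.

(** Complements the mass formulas above, which concern histories of length exactly k. *)
Let pmass_size {T : choiceType} k (N : Omega TX TY -> T) (g : T -> seq round) t :
  (forall o, g (N o) = S k o) -> size (g t) != k -> pmass P N t = 0.
Proof.
move=> gN sz; apply/eqP; apply: contrapT => /negP n0.
have : 0 < pmass P N t by rewrite lt_neqAle eq_sym n0 (pmass_ge0 P0 P1).
by move=> /(pmass_gt0_ex P0 P1)[o /(size_S k) + e]; rewrite -gN e => e'; rewrite e' eqxx in sz.
Qed.

Let CI1 k o : 0 < P o ->
  surprisal P (fun o => (S k o, a k o)) o +
    surprisal P (fun o => (lh12 (S k o), lh31 (S k o))) o =
  surprisal P (S k) o + surprisal P (fun o => ((lh12 (S k o), lh31 (S k o)), a k o)) o.
Proof.
apply: (conditional_independence P0 P1 (e := fun h => (lh12 h, lh31 h))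
  (phi := fun l u => wAa l.1 l.2 u / wA l.1 l.2)) => [l u|h u].
  by rewrite divr_ge0.
have [<-|sz] := eqVneq (size h) k; first by rewrite massA massS /= -[in LHS]wAaE; ring.
by rewrite (pmass_size (k := k) (g := fst))// (pmass_size (k := k) (g := id))// mul0r.
Qed.

(** The simultaneous draws of a round are revealed one after the other. Link 12 already carries
    Alice's new message here, and the kernel ignores it because Bob draws from the links before the
    round. *)
Let CI2 k o : 0 < P o ->
  surprisal P (fun o => ((S k o, a k o), b k o)) o +
    surprisal P (fun o => ((lh12 (S k o), (a k o).1), lh23 (S k o))) o =
  surprisal P (fun o => (S k o, a k o)) o +
    surprisal P (fun o => (((lh12 (S k o), (a k o).1), lh23 (S k o)), b k o)) o.
Proof.
apply: (conditional_independence P0 P1 (S := fun o => (S k o, a k o))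
  (e := fun h => ((lh12 h.1, h.2.1), lh23 h.1))
  (phi := fun l u => wBb l.1.1 l.2 u / wB l.1.1 l.2)) => [l u|[h u] v].
  by rewrite divr_ge0.
have [<-|sz] := eqVneq (size h) k; first by rewrite massB massA /= -[in LHS]wBbE; ring.
rewrite (pmass_size (k := k) (g := fun t => t.1.1))//.
by rewrite (pmass_size (k := k) (g := fun t => t.1))// mul0r.
Qed.

(** Charlie has no input, so his own pmf is the kernel; it ignores the new messages of Alice and
    Bob. *)
Let CI3 k o : 0 < P o ->
  surprisal P (fun o => ((S k o, a k o), b k o, c k o)) o +
    surprisal P (fun o => ((lh31 (S k o), (a k o).2), (lh23 (S k o), (b k o).2))) o =
  surprisal P (fun o => ((S k o, a k o), b k o)) o +
    surprisal P (fun o => (((lh31 (S k o), (a k o).2), (lh23 (S k o), (b k o).2)), c k o)) o.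
Proof.
apply: (conditional_independence P0 P1 (S := fun o => ((S k o, a k o), b k o))
  (e := fun h => ((lh31 h.1.1, h.1.2.2), (lh23 h.1.1, h.2.2)))
  (phi := fun l u => charlie pi l.2.1 l.1.1 u)) => [l u|[[h u] v] w].
  exact: charlie_ge0.
have [<-|sz] := eqVneq (size h) k; first by rewrite massC massB /=; ring.
rewrite (pmass_size (k := k) (g := fun t => t.1.1.1))//.
by rewrite (pmass_size (k := k) (g := fun t => t.1.1))// mul0r.
Qed.

(** Induction on the rounds, each split into three uses of [interaction_step] with Alice, Bob and
    Charlie as the sender in turn; symmetry of the interaction moves the passive link to the middle
    position. *)
Lemma interaction_ge0 k : bounded_mean P (fun o => - interaction P
   (fun o => lh12 (S k o)) (fun o => lh23 (S k o)) (fun o => lh31 (S k o)) (S k) o) 0.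
Proof.
elim: k => [|k IH].
  (* Before the first round all histories are the same constant: four equal surprisals minus three
     leave a nonnegative one. *)
  apply: (bounded_meanW _ _ (bounded_mean0 P0 P1)) => // o Po.
  have S0 o' : 0 < P o' -> S 0 o' = [::] by move=> /(size_S 0)/size0nil.
  rewrite (eq_interaction P0 P1 (A' := S 0) (B' := S 0) (C' := S 0) (S' := S 0));
    try by move=> o' Po'; rewrite !S0.
  rewrite /interaction.
  have -> : surprisal P (fun o => (S 0 o, S 0 o)) o = surprisal P (S 0) o.
    by apply: (eq_surprisal P0 P1) => o' _; split => [->|[]].
  by have := surprisal_ge0 P0 P1 (S 0) o; lra.
have s1 := interaction_step P0 P1 (U := fun o => (a k o).1) (V := fun o => (a k o).2)
  (@CI1 k) IH.
have s2 := interaction_step P0 P1 (A := fun o => (lh12 (S k o), (a k o).1))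
  (C := fun o => lh23 (S k o)) (B := fun o => (lh31 (S k o), (a k o).2))
  (U := fun o => (b k o).1) (V := fun o => (b k o).2) (@CI2 k).
have {s1 s2} := s2 (bounded_meanW (lexx 0) _ s1) => s2.
have s3 := interaction_step P0 P1
  (A := fun o => (lh31 (S k o), (a k o).2))
  (C := fun o => (lh23 (S k o), (b k o).2))
  (B := fun o => ((lh12 (S k o), (a k o).1), (b k o).1))
  (U := fun o => (c k o).1) (V := fun o => (c k o).2) (@CI3 k).
apply: (bounded_meanW (lexx 0) _ (s3 (bounded_meanW (lexx 0) _ (s2 _)))).
- move=> o Po; rewrite lerN2.
  rewrite -(interactionAC P0 P1) -(interactionCA P0 P1).
  (* A link after this round carries the same information as the old link with its two new messages,
     whatever the order in which they were revealed. *)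
  have Se o' : 0 < P o' -> S k.+1 o' = rcons (S k o') (next_round k o'.2).
    by move=> /(input_law_gt0P piV piT pD)[_ l]; apply: round_history_rcons l.
  rewrite le_eqVlt; apply/orP; left; apply/eqP.
  apply: (eq_interaction P0 P1) => o' Po'; rewrite ?(Se o') ?(Se o)//.
  + rewrite /lh12 !map_rcons; split => [/rcons_inj[-> e1 e2]|]; first by congr (_, _, _).
    by move=> [[-> e1] e2]; congr rcons; congr pair.
  + rewrite /lh23 !map_rcons; split => [/rcons_inj[-> e1 e2]|]; first by congr (_, _, _).
    by move=> [[-> e1] e2]; congr rcons; congr pair.
  + rewrite /lh31 !map_rcons; split => [/rcons_inj[-> e1 e2]|]; first by congr (_, _, _).
    by move=> [[-> e1] e2]; congr rcons; congr pair.
  + rewrite /a /b /c; split => [/rcons_inj[-> ->]//|].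
    case: (next_round k o'.2) (next_round k o.2) => [[[? ?] [? ?]] [? ?]] [[[? ?] [? ?]] [? ?]] /=.
    by move=> [-> -> -> -> -> -> ->].
- by move=> o Po; rewrite lerN2 (interactionAC P0 P1) (interactionCA P0 P1).
- by move=> o Po; rewrite lerN2 (interactionCA P0 P1).
Qed.

End ProductInput.

End Rounds.

(** * Consequences of security *)

Section Privacy.
Context {R : realType} {TX TY TZ : finType}.
Variables (p : TX -> TY -> R) (f : TX -> TY -> TZ) (pi : protocol R TX TY TZ).
Hypotheses (pD : input_dist p) (pp : forall x y, 0 < p x y) (sec : secure p f pi).

Lemma secure_valid : valid_protocol pi. Proof. by case: sec. Qed.
Lemma secure_terminates : terminates pi. Proof. by case: sec. Qed.
Let piV := secure_valid.
Let piT := secure_terminates.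

Lemma secure_output x y m : 0 < law pi x y m -> output pi m.1.2 m.2 = f x y.
Proof. by case: sec => _ _ cor _ l; apply: cor; apply: law_neq0. Qed.

Lemma law_alice_view x y y' w :
  pmass (law pi x y) (fun m => (m.1.1, m.2)) w =
  pmass (law pi x y') (fun m => (m.1.1, m.2)) w.
Proof.
have [_ _ _ [mk _]] := sec.
apply: (markov_law piV piT pD (B := @rvX TX TY) (C := fun o => (rvY o, rvZ pi o))
  (b := fun x _ => x) (c := fun x y => (y, f x y))) => //.
- by move=> x1 y1 m l; rewrite /rvZ /rvM23 /rvM31/= (secure_output l).
- by move=> x1 y1 x2 y2 -> [->].
Qed.

Lemma law_bob_view x x' y w :
  pmass (law pi x y) fst w = pmass (law pi x' y) fst w.
Proof.
have [_ _ _ [_ [mk _]]] := sec.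
have := @markov_law _ _ _ _ _ piV piT _ pD _ _ _ (fun m => (m.1.1, m.1.2)) (@rvY TX TY)
  (fun o => (rvX o, rvZ pi o)) (fun _ y => y) (fun x y => (x, f x y)) pp _ _ mk x y x' y w.
have -> : (fun m : msg * msg * msg => (m.1.1, m.1.2)) = fst.
  by apply/funext => -[[]].
apply => //.
- by move=> x1 y1 m l; rewrite /rvZ /rvM23 /rvM31/= (secure_output l).
- by move=> x1 y1 x2 y2 -> [->].
Qed.

Lemma law_charlie_view x y x' y' w : f x y = f x' y' ->
  pmass (law pi x y) (fun m => (m.1.2, m.2)) w =
  pmass (law pi x' y') (fun m => (m.1.2, m.2)) w.
Proof.
have [_ _ _ [_ [_ mk]]] := sec.
apply: (markov_law piV piT pD (B := rvZ pi) (C := fun o => (rvX o, rvY o))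
  (b := f) (c := fun x y => (x, y))) => //.
by move=> x1 y1 m l; rewrite /rvZ /rvM23 /rvM31/= (secure_output l).
Qed.

(** Bob's view allows changing [x], and Alice's view then allows changing [y]. *)
Lemma law_m12 x y x' y' w :
  pmass (law pi x y) (fun m => m.1.1) w = pmass (law pi x' y') (fun m => m.1.1) w.
Proof.
transitivity (pmass (law pi x' y) (fun m => m.1.1) w).
  exact: (pmass_law_comp piV piT fst (law_bob_view x x' y)).
exact: (pmass_law_comp piV piT fst (law_alice_view x' y y')).
Qed.

(** By privacy against Alice, the input x' also produces her two transcripts when Bob holds [y]. Cut
    and paste then makes [m] possible under (x',y), and correctness on the same [m] gives f(x,y) =
    f(x',y). *)
Lemma alice_input_decodable x y m x' y' m' :
  (forall x x' y, f x y = f x' y -> x = x') ->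
  0 < law pi x y m -> 0 < law pi x' y' m' -> m.1.1 = m'.1.1 -> m.2 = m'.2 -> x = x'.
Proof.
move=> finj l l' e1 e3; apply: (finj _ _ y).
have Q0 x1 y1 := law_ge0 piV piT x1 y1.
have : 0 < pmass (law pi x' y) (fun m => (m.1.1, m.2)) (m.1.1, m.2).
  rewrite (law_alice_view x' y y') e1 e3.
  exact: (pmass_gt0 (Q0 _ _) (law_sum piV piT _ _) (fun m => (m.1.1, m.2)) l').
move=> /(pmass_gt0_ex (Q0 _ _) (law_sum piV piT _ _))[m2 l2 [h1 h3]].
have := mulr_gt0 l l2; rewrite (law_exchange_alice piV piT)// => ll.
have l3 : 0 < law pi x' y m.
  by rewrite lt_neqAle eq_sym Q0 andbT; apply: contraL ll => /eqP ->; rewrite mul0r ltxx.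
by rewrite -(secure_output l) -(secure_output l3).
Qed.

Lemma bob_input_decodable x y m x' y' m' :
  (forall x y y', f x y = f x y' -> y = y') ->
  0 < law pi x y m -> 0 < law pi x' y' m' -> m.1 = m'.1 -> y = y'.
Proof.
move=> finj l l' e1; apply: (finj x).
have Q0 x1 y1 := law_ge0 piV piT x1 y1.
have : 0 < pmass (law pi x y') fst m.1.
  rewrite (law_bob_view x x' y') e1.
  exact: (pmass_gt0 (Q0 _ _) (law_sum piV piT _ _) fst l').
move=> /(pmass_gt0_ex (Q0 _ _) (law_sum piV piT _ _))[m2 l2 h1].
have := mulr_gt0 l l2; rewrite (law_exchange_bob piV piT)// => ll.
have l3 : 0 < law pi x y' m.
  by rewrite lt_neqAle eq_sym Q0 andbT; apply: contraL ll => /eqP ->; rewrite mul0r ltxx.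
by rewrite -(secure_output l) -(secure_output l3).
Qed.

(** Conditioning on an input pair amounts to taking the point mass there as input distribution, so a
    bound on H(M31) valid for all input distributions survives conditioning. [K] is in nats. *)
Lemma centropy_ge {T : choiceType} (V : Omega TX TY -> T) (K : R) :
  (forall o o', V o = V o' -> o.2.2 = o'.2.2) ->
  (forall q, input_dist q ->
    (K%:E <= expect (input_law pi q) (surprisal (input_law pi q) (fun o => o.2.2)))%E) ->
  0 <= K ->
  ((K / ln 2)%:E <= centropy (joint p pi) V (fun w => (rvX w, rvY w)))%E.
Proof.
move=> V31 HK K0.
have ln2 : 0 <= (ln 2 : R)^-1 by rewrite invr_ge0 ln_ge0// ler1n.
have P0 := input_law_ge0 piV piT pD; have P1 := input_law_sum piV piT pD.
have -> : (fun w : Omega TX TY => (rvX w, rvY w)) = fst by apply/funext => -[[]].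
rewrite /centropy (joint_input_law piV piT) /pmfRV.
apply: (@le_trans _ _ (\esum_(u in [set: TX * TY]) (K / ln 2 * p u.1 u.2)%:E)).
  rewrite esum_EFinM ?divr_ge0//; last first.
  - by move=> u; rewrite ltW.
  - by rewrite -invr_ge0.
  rewrite esum_finType => [|u]; last by rewrite lee_fin ltW.
  by rewrite sumEFin; have [_ ->] := pD; rewrite mule1.
apply: le_esum => u _.
rewrite -(pmassE P0 P1) (input_law_input piV piT pD) mulrC EFinM.
apply: lee_wpmul2l; first by rewrite lee_fin ltW.
pose q x y : R := ((x, y) == u)%:R.
have qD : input_dist q.
  split => [x y|]; first by rewrite /q ler0n.
  rewrite (bigD1 u)//= /q -surjective_pairing eqxx big1 ?addr0// => xy /negPf.
  by rewrite -surjective_pairing => ->.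
have -> : condP (fun o => (input_law pi p o)%:E) fst u = (fun o => (input_law pi q o)%:E).
  apply/funext => -[[x y] m]; rewrite /condP /pmfRV -(pmassE P0 P1)/=.
  rewrite (input_law_input piV piT pD) /input_law /q/=.
  case: eqVneq => [<-|_]; last by rewrite mul0r.
  by rewrite mul1r mulrAC mulfV ?mul1r// gt_eqF.
have Q0 := input_law_ge0 piV piT qD; have Q1 := input_law_sum piV piT qD.
rewrite (entropyE _ Q0 Q1) mulrC EFinM lee_wpmul2l ?lee_fin//.
apply: (le_trans (HK _ qD)); apply: (le_expect Q0) => o Po.
by apply: (le_surprisal Q0 Q1) => // o' _ /V31.
Qed.

End Privacy.

(** * The sum function *)

Section SumFunction.
Context {R : realType} {n : nat}.
Implicit Types (x y : bitvec n) (z : tritvec n).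

Lemma sumfE x y i : sumf x y i = (x i + y i)%N :> nat.
Proof. by rewrite ffunE inordK//; case: (x i); case: (y i). Qed.

Lemma sumfC x y : sumf x y = sumf y x.
Proof. by apply/ffunP => i; apply/val_inj; rewrite /= !sumfE addnC. Qed.

Lemma sumf_injl x x' y : sumf x y = sumf x' y -> x = x'.
Proof.
move=> /ffunP e; apply/ffunP => i; have := congr1 val (e i).
by rewrite /= !sumfE => /addIn; case: (x i); case: (x' i).
Qed.

Lemma sumf_injr x y y' : sumf x y = sumf x y' -> y = y'.
Proof. by rewrite ![sumf x _]sumfC; apply: sumf_injl. Qed.

(** Unary coding of each trit, a section of the sum. *)
Definition split_trits z : bitvec n * bitvec n :=
  ([ffun i => 0 < z i]%N, [ffun i => 1 < z i]%N).

Lemma split_tritsK z : sumf (split_trits z).1 (split_trits z).2 = z.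
Proof.
apply/ffunP => i; apply/val_inj; rewrite /= sumfE !ffunE.
by case: (z i) => -[|[|[]]].
Qed.

(* The uniform distribution on the pairs with y <= x, for which the sum is
   uniform. *)
Definition split_dist x y : R :=
  if split_trits (sumf x y) == (x, y) then (3 ^+ n)^-1 else 0.

Lemma split_distP : input_dist split_dist.
Proof.
split => [x y|]; first by rewrite /split_dist; case: ifP; rewrite ?invr_ge0 ?exprn_ge0.
rewrite /split_dist -big_mkcond/=.
rewrite (reindex_onto split_trits (fun xy => sumf xy.1 xy.2)); last first.
  by move=> [x y] /= /eqP.
rewrite (eq_bigl xpredT) => [|z]; last by rewrite split_tritsK -surjective_pairing !eqxx.
rewrite sumr_const card_ffun !card_ord -[LHS]mulr_natl natrX mulfV//.
Qed.

Definition unif : R := (2 ^+ n)^-1.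

Lemma unif_gt0 : 0 < unif.
Proof. by rewrite invr_gt0 exprn_gt0. Qed.

Lemma sum_unif : \sum_(x : bitvec n) unif = 1.
Proof.
rewrite sumr_const card_ffun card_ord card_bool -[LHS]mulr_natl natrX mulfV//.
Qed.

Lemma unif_distP : input_dist (fun x y => unif * unif).
Proof.
split => [x y|]; first by rewrite mulr_ge0// ltW// unif_gt0.
rewrite -(pair_big xpredT xpredT (fun=> fun=> unif * unif))/=.
under eq_bigr do rewrite -mulr_sumr sum_unif mulr1.
exact: sum_unif.
Qed.

(** The law 1/4, 1/2, 1/4 of the sum of two independent fair bits. *)
Definition trit_weight (k : nat) : R := if k == 1%N then 2^-1 else 4^-1.

Lemma unif_sum_mass z :
  \sum_(xy : bitvec n * bitvec n | sumf xy.1 xy.2 == z) unif * unif =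
  \prod_i trit_weight (z i).
Proof.
have eqE x y : (sumf x y == z) = [forall i, (x i + y i)%N == z i].
  apply/eqP/forallP => [<- i|h]; first by rewrite sumfE.
  by apply/ffunP => i; apply/val_inj; rewrite /= sumfE; apply/eqP.
transitivity (\sum_(x : bitvec n) \sum_(y : bitvec n) \prod_i (4^-1 * ((x i + y i)%N == z i)%:R : R)).
  rewrite big_mkcond/= pair_big/=; apply: eq_bigr => -[x y] _ /=.
  rewrite eqE big_split/= prodr_const card_ord.
  have -> : unif * unif = 4^-1 ^+ n.
    by rewrite /unif -exprVn -exprMn -invfM -natrM.
  case: ifPn => [/forallP h|]; first by rewrite big1 ?mulr1// => i _; rewrite h.
  rewrite negb_forall => /existsP[i /negPf hi].
  by rewrite [X in _ * X](bigD1 i)//= hi mul0r mulr0.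
transitivity (\sum_(x : bitvec n) \prod_i \sum_(b : bool)
    (4^-1 * ((x i + b)%N == z i)%:R : R)).
  by apply: eq_bigr => x _; rewrite bigA_distr_bigA.
rewrite -(bigA_distr_bigA (fun i (a : bool) => \sum_(b : bool) 4^-1 * ((a + b)%N == z i)%:R)).
apply: eq_bigr => i _; rewrite !big_bool/= /trit_weight.
by case: (z i) => -[|[|[]]]//= _; lra.
Qed.

(** This is -H(X+Y) in nats. In each coordinate, flipping the bit of y pairs a weight 1/2 with a
    weight 1/4, so the logarithm averages to -3/2 ln 2. *)
Lemma mean_log_trit_weight :
  \sum_(xy : bitvec n * bitvec n) unif * unif *
     ln (\prod_i trit_weight (sumf xy.1 xy.2 i)) = - (3 / 2 * n%:R * ln 2).
Proof.
have w0 k : 0 < trit_weight k by rewrite /trit_weight; case: ifP; rewrite invr_gt0.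
pose L (b c : bool) : R := ln (trit_weight (b + c)%N).
have lnprod x y : ln (\prod_i trit_weight (sumf x y i)) = \sum_i L (x i) (y i).
  under eq_bigr do rewrite sumfE.
  (* Positivity is carried along the induction because [lnM] requires it. *)
  apply: (proj2 (_ : 0 < \prod_i trit_weight (x i + y i)%N /\ _)).
  apply: (big_ind2 (fun a b => 0 < a /\ ln a = b)) => [|a b c d [a0 <-] [c0 <-]|//].
    by rewrite ln1.
  by rewrite mulr_gt0 ?lnM.
have Lflip b c : L b c + L b (~~ c) = - (3 * ln 2).
  have l4 : ln (4^-1 : R) = - (2 * ln 2).
    by rewrite lnV ?posrE// (_ : 4 = 2 * 2) ?lnM ?posrE -?natrM//; lra.
  have l2 : ln (2^-1 : R) = - ln 2 by rewrite lnV ?posrE.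
  by rewrite /L /trit_weight; case: b; case: c => /=; rewrite l4 l2; lra.
have half x i : \sum_(y : bitvec n) L (x i) (y i) = \sum_(y : bitvec n) - (3 / 2 * ln 2).
  pose flip y : bitvec n := [ffun j => if j == i then ~~ y j else y j].
  have flipK : involutive flip.
    by move=> y; apply/ffunP => j; rewrite !ffunE; case: eqP => // _; rewrite negbK.
  have e : \sum_(y : bitvec n) L (x i) (y i) = \sum_(y : bitvec n) L (x i) (~~ (y i)).
    rewrite (reindex_inj (inv_inj flipK)); apply: eq_bigr => y _.
    by rewrite ffunE eqxx.
  apply: (mulfI (x := 2)) => //; rewrite mulr_natl mulr2n {2}e -big_split/=.
  by rewrite mulr_sumr; apply: eq_bigr => y _; rewrite Lflip; lra.
under eq_bigr do rewrite lnprod mulr_sumr.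
rewrite exchange_big/=.
have perbit i : \sum_(xy : bitvec n * bitvec n) unif * unif * L (xy.1 i) (xy.2 i) =
    - (3 / 2 * ln 2).
  rewrite -(pair_big xpredT xpredT (fun x y => unif * unif * L (x i) (y i)))/=.
  under eq_bigr => x _ do rewrite -mulr_sumr half mulr_sumr -mulr_suml -mulr_sumr sum_unif mulr1.
  by rewrite -mulr_suml sum_unif mul1r.
under eq_bigr do rewrite perbit.
by rewrite sumr_const card_ord -[LHS]mulr_natl; lra.
Qed.

End SumFunction.

Arguments unif {R} n.

(** Recovers a link history from the transcript of that link alone, whereas [round_history] reads
    all three; this is what makes a link history inherit the privacy of its transcript. *)
Definition parse (c1 c2 : lhist -> msg -> bool) t (s : msg) : lhist :=
  xget [::] [set l | [/\ size l = t, link_valid c1 c2 l & prefix (trans l) s]].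

Lemma parseE c1 c2 t s l : (forall l, prefix_free (c1 l)) -> (forall l, prefix_free (c2 l)) ->
  size l = t -> link_valid c1 c2 l -> prefix (trans l) s -> parse c1 c2 t s = l.
Proof.
move=> f1 f2 sz lv ls; rewrite /parse; case: xgetP => [l' _ [sz' v' s']|].
  by apply: (parse_unique f1 f2 _ v' lv s' ls); rewrite sz sz'.
by move=> /(_ l) nl; exfalso; apply: nl.
Qed.

(** * Entropy bounds for the sum function *)

Section SumBounds.
Context {R : realType} {n : nat}.
Variables (p : bitvec n -> bitvec n -> R) (pi : protocol R (bitvec n) (bitvec n) (tritvec n)).
Hypotheses (pD : input_dist p) (pp : forall x y, 0 < p x y) (sec : secure p (@sumf n) pi).
Let piV := secure_valid sec.
Let piT := secure_terminates sec.
Implicit Types x y : bitvec n.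

(** Path (x,y), (x,x'), (x',x), (x',y') of inputs: Alice's view does not see the outer changes, and
    Charlie's does not see the middle one since the sum is commutative. *)
Lemma sum_law_m31 x y x' y' w :
  pmass (law pi x y) (fun m => m.2) w = pmass (law pi x' y') (fun m => m.2) w.
Proof.
transitivity (pmass (law pi x x') (fun m => m.2) w).
  exact: (pmass_law_comp piV piT snd (law_alice_view pD pp sec x y x')).
transitivity (pmass (law pi x' x) (fun m => m.2) w).
  apply: (pmass_law_comp piV piT snd (W := fun m => (m.1.2, m.2))) => v.
  by apply: (law_charlie_view pD pp sec); apply: sumfC.
exact: (pmass_law_comp piV piT snd (law_alice_view pD pp sec x' x y')).
Qed.

Lemma sum_law_m23 x y x' y' w :
  pmass (law pi x y) (fun m => m.1.2) w = pmass (law pi x' y') (fun m => m.1.2) w.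
Proof.
transitivity (pmass (law pi y' y) (fun m => m.1.2) w).
  exact: (pmass_law_comp piV piT snd (law_bob_view pD pp sec x y' y)).
transitivity (pmass (law pi y y') (fun m => m.1.2) w).
  apply: (pmass_law_comp piV piT fst (W := fun m => (m.1.2, m.2))) => v.
  by apply: (law_charlie_view pD pp sec); apply: sumfC.
exact: (pmass_law_comp piV piT snd (law_bob_view pD pp sec y x' y')).
Qed.

(** H(W) >= H(W,W') - H(W') >= H(X,Y,W') - H(W') = H(X,Y) = n ln 3 under [split_dist], where the
    input pair is a function of its sum and hence of (W,W'). *)
Lemma sum_transcript_bound (W W' : msg * msg * msg -> msg) (q : bitvec n -> bitvec n -> R) :
  input_dist q ->
  (forall x y x' y' w, pmass (law pi x y) W w = pmass (law pi x' y') W w) ->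
  (forall x y x' y' w, pmass (law pi x y) W' w = pmass (law pi x' y') W' w) ->
  (forall m m', W m = W m' -> W' m = W' m' -> m.1.2 = m'.1.2 /\ m.2 = m'.2) ->
  ((n%:R * ln 3)%:E <=
    expect (input_law pi q) (surprisal (input_law pi q) (fun o => W o.2)))%E.
Proof.
move=> qD cW cW' WW'; have sD := @split_distP R n.
rewrite (expect_surprisal_law piV piT qD sD cW).
set P := input_law pi split_dist.
have P0 : forall o, 0 <= P o := input_law_ge0 piV piT sD.
have P1 : \esum_(o in [set: _]) (P o)%:E = 1%E := input_law_sum piV piT sD.
apply: (bounded_mean_opp P0 P1) => [o|]; first exact: surprisal_ge0.
(* Conditioning on a constant turns submodularity into subadditivity. *)
have D := submodularity P0 P1 (fun o => W o.2) (fun o => W' o.2) (fun=> tt).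
have B := bounded_meanD P0 D (bounded_mean_finite P0 P1 (fun=> tt) (fun=> - (n%:R * ln 3))).
apply: (bounded_meanW _ _ B).
  rewrite add0r (bigD1 tt)//= big1 ?addr0 => [|[] //].
  have -> : pmass P (fun=> tt) tt = 1; last by rewrite mul1r.
  apply: EFin_inj; rewrite (pmassE P0 P1) -P1; congr esum.
  by apply/seteqP; split.
move=> o Po /=; have [so lo] := input_law_gt0P piV piT sD Po.
have on_split o' : 0 < P o' -> o'.1 = split_trits (sumf o'.1.1 o'.1.2).
  move=> /(input_law_gt0P piV piT sD)[+ _]; rewrite /split_dist.
  by case: eqP => [-> _|_]; rewrite ?ltxx// -surjective_pairing.
have tt_o (T : choiceType) (V : Omega (bitvec n) (bitvec n) -> T) :
    surprisal P (fun o => (tt, V o)) o = surprisal P V o.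
  by apply: (eq_surprisal P0 P1) => o' _; split => [->|[->]].
rewrite !tt_o.
have ZM : surprisal P (fun o => (o.1, W' o.2)) o <= surprisal P (fun o => (tt, W o.2, W' o.2)) o.
  apply: (le_surprisal P0 P1) => // o' Po' [eW eW'].
  have [e1 e2] := WW' _ _ eW eW'; have [_ lo'] := input_law_gt0P piV piT sD Po'.
  rewrite eW' (on_split _ Po) (on_split _ Po').
  by rewrite -(secure_output sec lo) -(secure_output sec lo') e1 e2.
have := surprisal_input_indep piV piT id sD cW' Po; rewrite -/P.
have -> : surprisal P (fun o => id o.1) o = n%:R * ln 3.
  rewrite /surprisal (input_law_input piV piT sD) {1}/split_dist.
  have /eqP := on_split _ Po; rewrite eq_sym [X in _ == X]surjective_pairing => ->.
  by rewrite lnV ?posrE ?exprn_gt0// opprK lnXn// mulr_natl.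
have := surprisal_ge0 P0 P1 (fun=> tt) o.
by move: ZM => /= ? ? ?; lra.
Qed.

Let q2 x y : R := unif n * unif n.
Let qD : input_dist q2 := unif_distP.
Let P := input_law pi q2.
Let P0 : forall o, 0 <= P o := input_law_ge0 piV piT qD.
Let P1 : \esum_(o in [set: _]) (P o)%:E = 1%E := input_law_sum piV piT qD.

Let S t (o : Omega (bitvec n) (bitvec n)) := round_history pi t o.2.

Let SP t o : 0 < P o -> [/\ size (S t o) = t, hist_valid pi (S t o) &
  prefix3 (transcripts (S t o)) o.2].
Proof.
move=> /(input_law_gt0P piV piT qD)[_ l].
exact: (round_historyP piV t (law_neq0 piV piT l)).
Qed.

Let parse12 t x y m : 0 < law pi x y m ->
  lh12 (round_history pi t m) = parse (code_ab pi) (code_ba pi) t m.1.1.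
Proof.
move=> l; have [sz [v1 v2 v3] /and3P[q1 _ _]] := round_historyP piV t (law_neq0 piV piT l).
have [[f1 [f2 _]] _] := piV.
by symmetry; apply: parseE => //; rewrite size_map.
Qed.

Let parse23 t x y m : 0 < law pi x y m ->
  lh23 (round_history pi t m) = parse (code_bc pi) (code_cb pi) t m.1.2.
Proof.
move=> l; have [sz [v1 v2 v3] /and3P[_ q1 _]] := round_historyP piV t (law_neq0 piV piT l).
have [[_ [_ [f1 [f2 _]]]] _] := piV.
by symmetry; apply: parseE => //; rewrite size_map.
Qed.

Let parse31 t x y m : 0 < law pi x y m ->
  lh31 (round_history pi t m) = parse (code_ca pi) (code_ac pi) t m.2.
Proof.
move=> l; have [sz [v1 v2 v3] /and3P[_ _ q1]] := round_historyP piV t (law_neq0 piV piT l).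
have [[_ [_ [_ [_ [f1 f2]]]]] _] := piV.
by symmetry; apply: parseE => //; rewrite size_map.
Qed.

Let law_B t x y x' y' w :
  pmass (law pi x y) (fun m => lh23 (round_history pi t m)) w =
  pmass (law pi x' y') (fun m => lh23 (round_history pi t m)) w.
Proof.
have L x1 y1 : pmass (law pi x1 y1) (fun m => lh23 (round_history pi t m)) w =
  pmass (law pi x1 y1) (parse (code_bc pi) (code_cb pi) t \o (fun m => m.1.2)) w.
  apply: (eq_pmass_fun (law_ge0 piV piT _ _) (law_sum piV piT _ _)) => m l.
  exact: (parse23 t l).
by rewrite !L; apply: (pmass_law_comp piV piT) => v; apply: sum_law_m23.
Qed.

Let law_C t x y x' y' w :
  pmass (law pi x y) (fun m => lh31 (round_history pi t m)) w =
  pmass (law pi x' y') (fun m => lh31 (round_history pi t m)) w.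
Proof.
have L x1 y1 : pmass (law pi x1 y1) (fun m => lh31 (round_history pi t m)) w =
  pmass (law pi x1 y1) (parse (code_ca pi) (code_ac pi) t \o (fun m => m.2)) w.
  apply: (eq_pmass_fun (law_ge0 piV piT _ _) (law_sum piV piT _ _)) => m l.
  exact: (parse31 t l).
by rewrite !L; apply: (pmass_law_comp piV piT) => v; apply: sum_law_m31.
Qed.

Let x0 : bitvec n := [ffun=> false].

(** Any input compatible with Alice's transcripts; [alice_input_decodable] makes it unique, and [x0]
    is the default when there is none. *)
Let decode_alice (l1 l3 : lhist) : bitvec n := xget x0
  [set x | exists y m, [/\ 0 < law pi x y m, m.1.1 = trans l1 & m.2 = trans l3]].
Let decode_bob (l1 l2 : lhist) : bitvec n := xget x0
  [set y | exists x m, [/\ 0 < law pi x y m, m.1.1 = trans l1 & m.1.2 = trans l2]].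

(** The event that the messages after round t add nothing to the transcripts. *)
Let complete t (o : Omega (bitvec n) (bitvec n)) : bool := transcripts (S t o) == o.2.

Let decode_aliceE t o : 0 < P o -> complete t o ->
  o.1.1 = decode_alice (lh12 (S t o)) (lh31 (S t o)).
Proof.
move=> /(input_law_gt0P piV piT qD)[_ l] /eqP tr.
have e1 : trans (lh12 (S t o)) = o.2.1.1 by rewrite -tr.
have e3 : trans (lh31 (S t o)) = o.2.2 by rewrite -tr.
rewrite /decode_alice e1 e3; case: xgetP => [x _ [y [m [l' h1 h3]]]|nx].
  symmetry; apply: (alice_input_decodable pD pp sec _ l' l) => //.
  exact: sumf_injl.
by exfalso; apply: (nx o.1.1); exists o.1.2, o.2.
Qed.

Let decode_bobE t o : 0 < P o -> complete t o ->
  o.1.2 = decode_bob (lh12 (S t o)) (lh23 (S t o)).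
Proof.
move=> /(input_law_gt0P piV piT qD)[_ l] /eqP tr.
have e1 : trans (lh12 (S t o)) = o.2.1.1 by rewrite -tr.
have e3 : trans (lh23 (S t o)) = o.2.1.2 by rewrite -tr.
rewrite /decode_bob e1 e3; case: xgetP => [y _ [x [m [l' h1 h3]]]|ny].
  symmetry; apply: (bob_input_decodable pD pp sec _ l' l) => //.
    exact: sumf_injr.
  by rewrite [m.1]surjective_pairing [o.2.1]surjective_pairing h1 h3.
by exfalso; apply: (ny o.1.2); exists o.1.1, o.2.
Qed.

Let outputE t o : 0 < P o -> complete t o ->
  sumf o.1.1 o.1.2 = output pi (trans (lh23 (S t o))) (trans (lh31 (S t o))).
Proof.
move=> /(input_law_gt0P piV piT qD)[_ l] /eqP tr.
by rewrite -(secure_output sec l) -tr.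
Qed.

Let error t := 1 - pmass P (complete t) true.

(** Decoding can fail only before completion; the common bound [L] gives the decodings of bit and
    trit vectors the same error term. *)
Let fano_complete (T : finType) (U : choiceType) (X : Omega (bitvec n) (bitvec n) -> T)
    (W : Omega (bitvec n) (bitvec n) -> U) (g : U -> T) (d L : R) t : 0 < d < 1 ->
  ln (#|T|%:R / d) <= L -> 0 <= L -> 0 <= error t ->
  (forall o, 0 < P o -> complete t o -> X o = g (W o)) ->
  bounded_mean P (fun o => surprisal P (fun o => (W o, X o)) o - surprisal P W o)
    (- ln (1 - d) + error t * L).
Proof.
move=> d01 lL L0 e0 Xg.
apply: (bounded_meanW _ _ (fano P0 P1 X W g d01)) => //.
have le_err : 1 - pmass P (fun o => X o == g (W o)) true <= error t.
  rewrite lerD2l lerN2; apply: (le_pmass_imp P0 P1) => o Po c.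
  by rewrite Xg ?eqxx.
have er0 : 0 <= 1 - pmass P (fun o => X o == g (W o)) true.
  by rewrite subr_ge0 (pmass_le1 P0 P1).
rewrite lerD2l; apply: (@le_trans _ _ ((1 - pmass P (fun o => X o == g (W o)) true) * L)).
  exact: ler_wpM2l.
exact: ler_wpM2r.
Qed.

Let surprisal_Z o : surprisal P (fun o => sumf o.1.1 o.1.2) o =
  - ln (\prod_i trit_weight (sumf o.1.1 o.1.2 i)).
Proof.
congr (- ln _); rewrite -unif_sum_mass.
apply: EFin_inj; rewrite (pmassE P0 P1) (input_law_esum piV piT qD).
rewrite [in RHS]big_mkcond/= -sumEFin; apply: eq_bigr => xy _.
case: ifPn => [/eqP <-|/eqP ne].
  rewrite -[RHS]mule1 -(law_sum piV piT xy.1 xy.2); congr (_ * esum _ _)%E.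
  by apply/seteqP; split.
by rewrite esum1 ?mule0.
Qed.

Let lnu : ln (unif n) = - (n%:R * ln 2) :> R.
Proof. by rewrite /unif lnV ?posrE ?exprn_gt0// lnXn// mulr_natl. Qed.

Let surprisal_XY o : surprisal P fst o = 2 * (n%:R * ln 2).
Proof.
rewrite /surprisal (input_law_input piV piT qD) /q2 lnM ?posrE ?unif_gt0// lnu.
lra.
Qed.

Let surprisal_X o : surprisal P (fun o => o.1.1) o = n%:R * ln 2.
Proof.
rewrite -[RHS]opprK -lnu; congr (- ln _).
apply: EFin_inj; rewrite -(pmass_pair P0 P1 (fun o => o.1.1) (fun o => o.1.2)).
rewrite esum_finType => [|y]; last by rewrite lee_fin (pmass_ge0 P0 P1).
rewrite sumEFin; congr (_%:E); rewrite -[RHS]mulr1 -(@sum_unif R n) mulr_sumr.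
apply: eq_bigr => y _; rewrite -[RHS](input_law_input piV piT qD (o.1.1, y)).
by apply: (eq_pmass P0 P1) => -[[x1 y1] m] _ /=.
Qed.

Let surprisal_Y o : surprisal P (fun o => o.1.2) o = n%:R * ln 2.
Proof.
rewrite -[RHS]opprK -lnu; congr (- ln _).
apply: EFin_inj; rewrite -(pmass_pair P0 P1 (fun o => o.1.2) (fun o => o.1.1)).
rewrite esum_finType => [|y]; last by rewrite lee_fin (pmass_ge0 P0 P1).
rewrite sumEFin; congr (_%:E); rewrite -[RHS]mulr1 -(@sum_unif R n) mulr_sumr.
apply: eq_bigr => x _; rewrite -[RHS](input_law_input piV piT qD (x, o.1.2)).
by apply: (eq_pmass P0 P1) => -[[x1 y1] m] _ /=; split => -[-> ->].
Qed.

(* H(M12) >= H(A) >= H(A|C) + I(A;C|B) up to o(1) for the histories A, B, C of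
   the three links after t rounds; the first term is at least H(X) and the
   second at least I(Y;Z) since C is independent of X and B of (Y,Z). *)
Let m12_mean t (d L : R) : 0 < d < 1 ->
  ln (#|{: bitvec n}|%:R / d) <= L -> ln (#|{: tritvec n}|%:R / d) <= L -> 0 <= L ->
  bounded_mean P (fun o => - surprisal P (fun o => o.2.1.1) o)
    (- (3 / 2 * n%:R * ln 2 - 3 * (- ln (1 - d) + error t * L))).
Proof.
move=> d01 L2 L3 L0.
have e0 : 0 <= error t by rewrite subr_ge0 (pmass_le1 P0 P1).
pose A o := lh12 (S t o); pose B o := lh23 (S t o); pose C o := lh31 (S t o).
pose X (o : Omega (bitvec n) (bitvec n)) := o.1.1.
pose Y (o : Omega (bitvec n) (bitvec n)) := o.1.2.
pose Z (o : Omega (bitvec n) (bitvec n)) := sumf o.1.1 o.1.2.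
have F1 := fano_complete (X := X) (W := fun o => (A o, C o))
  (g := fun l => decode_alice l.1 l.2) d01 L2 L0 e0 (@decode_aliceE t).
have F2 := fano_complete (X := Y) (W := fun o => (A o, B o))
  (g := fun l => decode_bob l.1 l.2) d01 L2 L0 e0 (@decode_bobE t).
have F3 := fano_complete (X := Z) (W := fun o => (B o, C o))
  (g := fun l => output pi (trans l.1) (trans l.2)) d01 L3 L0 e0 (@outputE t).
have I := interaction_ge0 piV piT (al := fun=> unif n) (be := fun=> unif n)
  (fun=> ltW unif_gt0) (fun=> ltW unif_gt0) qD t.
(* These are I(A;Z,C|Y,B) >= 0 and I(C;Y|Z,B) >= 0. *)
have D1 := submodularity P0 P1 A (fun o => (Z o, C o)) (fun o => (Y o, B o)).
have D2 := submodularity P0 P1 C Y (fun o => (Z o, B o)).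
(* [M] is minus the surprisal of [Z]; its mean -3/2 n ln 2 provides the main term. *)
have M := bounded_mean_finite P0 P1 fst
  (fun xy => ln (\prod_i trit_weight (sumf xy.1 xy.2 i))).
have Bd := bounded_meanD P0 (bounded_meanD P0 (bounded_meanD P0 F1 F2)
  (bounded_meanD P0 F3 I)) (bounded_meanD P0 (bounded_meanD P0 D1 D2) M).
apply: (bounded_meanW _ _ Bd).
  under eq_bigr do rewrite (input_law_input piV piT qD).
  rewrite mean_log_trit_weight; lra.
move=> o Po /=.
have hA : surprisal P A o <= surprisal P (fun o => o.2.1.1) o.
  apply: (le_surprisal P0 P1) => // o' Po' e.
  have [_ l] := input_law_gt0P piV piT qD Po.
  have [_ l'] := input_law_gt0P piV piT qD Po'.
  by rewrite /A /S (parse12 t l) (parse12 t l') e.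
have hS : surprisal P (S t) o <= surprisal P (fun o => ((Y o, B o), A o, (Z o, C o))) o.
  apply: (le_surprisal P0 P1) => // o' _ [_ eB eA _ eC].
  exact: links_inj.
have hXC : surprisal P (fun o => (X o, C o)) o <=
    surprisal P (fun o => ((A o, C o), X o)) o.
  by apply: (le_surprisal P0 P1) => // o' _ [_ -> ->].
have iXC := surprisal_input_indep piV piT fst qD (law_C t) Po.
have iYB := surprisal_input_indep piV piT snd qD (law_B t) Po.
have iZB := surprisal_input_indep piV piT (fun xy => sumf xy.1 xy.2) qD (law_B t) Po.
have iYZB := surprisal_input_indep piV piT id qD (law_B t) Po.
have s1 : surprisal P (fun o => ((Y o, B o), (Z o, C o))) o =
    surprisal P (fun o => ((Z o, B o), C o, Y o)) o.
  by apply: (eq_surprisal P0 P1) => o' _; split => -[-> -> -> ->].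
have s2 : surprisal P (fun o => ((Z o, B o), Y o)) o =
    surprisal P (fun o => (id o.1, B o)) o.
  apply: (eq_surprisal P0 P1) => o' _; rewrite /Z /Y; split; last first.
    move=> [eZ -> eY]; congr pair; rewrite [o'.1]surjective_pairing [o.1]surjective_pairing.
    by rewrite eY; congr pair; rewrite eY in eZ; apply: sumf_injl eZ.
  by move=> [/= e ->]; rewrite e.
have s3 : surprisal P (fun o => ((Y o, B o), A o)) o =
    surprisal P (fun o => ((A o, B o), Y o)) o.
  by apply: (eq_surprisal P0 P1) => o' _; split => -[-> -> ->].
have s4 : surprisal P (fun o => ((Z o, B o), C o)) o =
    surprisal P (fun o => ((B o, C o), Z o)) o.
  by apply: (eq_surprisal P0 P1) => o' _; split => -[-> -> ->].
have hX := surprisal_X o; have hY := surprisal_Y o; have hXY := surprisal_XY o.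
have hZ := surprisal_Z o.
(* In the sum the pair surprisals of the links cancel, [hS] absorbs the full history, and
   independence splits the remaining joint terms. The surprisals of X and Y add up to that of (X,Y),
   so that [M] against the surprisal of [Z] leaves only the surprisal of [A]. *)
move: hA hS hXC iXC iYB iZB iYZB s1 s2 s3 s4 hX hY hXY hZ.
rewrite -/P /interaction -/A -/B -/C -/X -/Y -/Z /=.
lra.
Qed.

Lemma sum_m12_bound (q : bitvec n -> bitvec n -> R) : input_dist q ->
  ((3 / 2 * n%:R * ln 2)%:E <=
    expect (input_law pi q) (surprisal (input_law pi q) (fun o => o.2.1.1)))%E.
Proof.
move=> q'D; rewrite (expect_surprisal_law piV piT q'D qD (W := fun m => m.1.1)); last first.
  exact: (law_m12 pD pp sec).
apply/lee_addgt0Pr => e e0.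
(* Chosen so that -ln(1-d) = e/6. With t such that [error t * L] is at most e/6 as well, the three
   Fano terms cost at most e altogether. *)
pose d : R := 1 - expR (- (e / 6)).
have d01 : 0 < d < 1.
  have := expR_gt0 (- (e / 6)); have : expR (- (e / 6)) < 1 by rewrite expR_lt1; lra.
  by rewrite /d; lra.
have ld : - ln (1 - d) = e / 6 by rewrite /d subKr expRK opprK.
have lge (T : finType) (a : T) : 0 <= ln (#|T|%:R / d).
  have [d0 d1] := andP d01; have T1 : 1 <= #|T|%:R :> R.
    by rewrite ler1n; apply/card_gt0P; exists a.
  by rewrite ln_ge0// ler_pdivlMr// mul1r; lra.
have l2 := lge _ x0; have l3 := lge _ (sumf x0 x0).
(* The summand 1 makes [L] positive, so that it can be divided by. *)
pose L := ln (#|{: bitvec n}|%:R / d) + ln (#|{: tritvec n}|%:R / d) + 1.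
have L0 : 0 < L by rewrite /L; lra.
have [t et] : exists t, error t <= e / 6 / L.
  apply: (eventually_almost_sure P0 P1); last by rewrite !divr_gt0.
  move=> o /(input_law_gt0P piV piT qD)[_ l].
  have [t0 h] := round_history_final piV (law_neq0 piV piT l).
  by exists t0 => t /h; rewrite /complete => ->.
have := m12_mean t d01 (L := L) _ _ (ltW L0).
move=> /(_ ltac:(rewrite /L; lra) ltac:(rewrite /L; lra)).
rewrite ld => /(bounded_mean_opp P0 P1 (fun o => surprisal_ge0 P0 P1 _ o)).
have eL : error t * L <= e / 6 by rewrite -ler_pdivlMr.
move=> h; rewrite -leeBlDr//; apply: le_trans h.
by rewrite -EFinB lee_fin; lra.
Qed.

End SumBounds.

(** * The bounds in bits *)

Unset Implicit Arguments.
Set Strict Implicit.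

Theorem theorem14 (R : realType) (n : nat) (p : bitvec n -> bitvec n -> R)
    (pi : protocol R (bitvec n) (bitvec n) (tritvec n)) :
  (1 <= n)%N ->
  full_support_dist p ->
  secure p (@sumf n) pi ->
  [/\ ((n%:R * log2 3)%:E <= entropy (joint p pi) (@rvM31 _ _))%E,
      ((n%:R * log2 3)%:E <= entropy (joint p pi) (@rvM23 _ _))%E,
      ((3 / 2 * n%:R)%:E <= entropy (joint p pi) (@rvM12 _ _))%E &
      ((n%:R * log2 3)%:E <= rho p (@sumf n))%E].
Proof.
move=> _ [pp p1] sec.
have pD : input_dist p by split => // x y; apply: ltW.
have ln2 : 0 < ln 2 :> R by rewrite ln_gt0// ltr1n.
have ln2V : 0 <= (ln 2 : R)^-1 by rewrite invr_ge0 ltW.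
(* Stated for all secure protocols and all input distributions: [rho] ranges over the former, and
   conditioning on the inputs changes the latter. *)
have M31 pi' (s : secure p (@sumf n) pi') q : input_dist q ->
    ((n%:R * ln 3)%:E <= expect (input_law pi' q)
      (surprisal (input_law pi' q) (fun o => o.2.2)))%E.
  move=> qD; apply: (sum_transcript_bound s (W := fun m => m.2) (W' := fun m => m.1.2)) => //.
  - exact: (sum_law_m31 pD pp s).
  - exact: (sum_law_m23 pD pp s).
have piV := secure_valid sec; have piT := secure_terminates sec.
have P0 := input_law_ge0 piV piT pD; have P1 := input_law_sum piV piT pD.
split.
- rewrite joint_input_law// entropyE// /log2 mulrA mulrC EFinM.
  by apply: lee_wpmul2l; rewrite ?lee_fin//; apply: M31.
- rewrite joint_input_law// entropyE// /log2 mulrA mulrC EFinM.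
  apply: lee_wpmul2l; rewrite ?lee_fin//.
  apply: (sum_transcript_bound sec (W := fun m => m.1.2) (W' := fun m => m.2)) => //.
  + exact: (sum_law_m23 pD pp sec).
  + exact: (sum_law_m31 pD pp sec).
- rewrite joint_input_law// entropyE//.
  have -> : 3 / 2 * n%:R = (ln 2)^-1 * (3 / 2 * n%:R * ln 2) :> R.
    by rewrite [RHS]mulrC mulfK ?gt_eqF.
  rewrite EFinM; apply: lee_wpmul2l; rewrite ?lee_fin//.
  exact: (sum_m12_bound pD pp sec).
- apply: le_ereal_inf_tmp => _ [pi' s <-]; rewrite /log2 mulrA.
  apply: (centropy_ge pD pp s) => [o o' []//|q qD|]; first exact: M31.
  by rewrite mulr_ge0// ln_ge0// ler1n.
Qed.
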